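(* Let $N\ge 2$ be an integer. For every $P(z)=z+\sum_{j=2}^N a_jz^j\in\mathcal T_N$ one has $$|a_2|\le \begin{cases}2\mu_N, & N \text{ odd},\\ 2\eta_N=2(1-2\nu_N^2), & N\text{ even},\end{cases}$$ where $\mu_N=\cos\frac{2\pi}{N+3}$, $\nu_N$ is the smallest positive root of the equation $U'_{N+2}(x)=0$, and $\eta_N$ is the maximal root of the equation $U'_{\frac N2+1}(x)-U'_{\frac N2}(x)=0$. These estimates are exact, and the extremal polynomials are as follows. (1) If $N$ is odd, the coefficients of the extremal polynomial for the upper bound ($a_2=2\mu_N$) are $a_1=1$ and, for $j=1,\dots,(N-1)/2$, $$a_{2j+1}=\frac2{N+3}\Big[\mu_N U_{j-1}(\mu_N)U_j(\mu_N)+\Big(\frac{N+3}2-j\Big)(U_j(\mu_N))^2-\Big(\frac{N+1}2-j\Big)(U_{j-1}(\mu_N))^2\Big],$$ $$a_{2j}=\frac4{N+3}U_{j-1}(\mu_N)\Big[\Big(\frac{N+3}2-j\Big)U_j(\mu_N)-\mu_N\Big(\frac{N+1}2-j\Big)U_{j-1}(\mu_N)\Big].$$ In compact form this polynomial is $$\frac z{1-2z\cos\frac{2\pi}{N+3}+z^2}+\frac4{N+3}\sin^2\frac{2\pi}{N+3}\cdot\frac{z^3}{1-z^2}\cdot\frac{1-z^{N+3}}{\left(1-2z\cos\frac{2\pi}{N+3}+z^2\right)^2}.$$ (2) If $N$ is even, the coefficients of the extremal polynomial for the upper bound ($a_2=2\eta_N$) are, for $s=1,\dots,N$, $$a_s=\frac{\gamma_s(\eta_N)-\gamma_{s+2}(\eta_N)}{\gamma_1(\eta_N)-\gamma_3(\eta_N)},\qquad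 \gamma_s(x)=\sum_{k=1}^{N-s+1}z_k^{(1)}(x)\,z_{k+s-1}^{(1)}(x)\ (1\le s\le N),\quad \gamma_{N+1}=\gamma_{N+2}=0,$$ with $z^{(1)}_k$ as defined in the context. In compact form this polynomial is $$\frac{z+z^5+\gamma_1^*(z^2+z^4)+\gamma_2^*z^3}{(1+z)^2(z^2+1-2\eta_Nz)^2}+Q_N\frac{8z^4\,h_N(z)}{(1-z)(1+z)^3(z^2+1-2\eta_Nz)^2},$$ where $$\gamma_1^*=2(1-\eta_N),\quad \gamma_2^*=\frac2{N+3}\big(-2\eta_N^2-2(N+3)\eta_N+N+5\big),\quad Q_N=\frac{2(1-\eta_N^2)}{(N+2)(N+3)(N+4)},$$ $$h_N(z)=\Big(\frac{N+4}2\Big)^2(1-z^{N+2})+\Big(\frac{N+2}2\Big)^2(1-z^{N+4})+\frac{(N+2)(N+4)}2(z-z^{N+3}).$$ (3) For the lower bounds ($a_2=-2\mu_N$ for $N$ odd, respectively $a_2=-2\eta_N$ for $N$ even), the coefficients of the extremal polynomial are obtained from those above by taking the coefficients with even indices with a minus sign.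
   Context: $\mathbb D=\{z\in\mathbb C:|z|<1\}$. A holomorphic function $F:\mathbb D\to\mathbb C$ is typically real if $F(z)\in\mathbb R$ for all $z\in\mathbb R\cap\mathbb D$ and $\mathrm{Im}\{F(z)\}\cdot\mathrm{Im}\{z\}>0$ for all $z\in\mathbb D\setminus\mathbb R$. $\mathcal T_N$ is the set of typically real polynomials of the form $P(z)=z+\sum_{j=2}^Na_jz^j$ with $a_j\in\mathbb R$. An extremal polynomial (extremizer) for the upper (lower) bound is a polynomial in $\mathcal T_N$ whose coefficient $a_2$ attains the bound. $U_j$ ($j\ge0$) is the Chebyshev polynomial of the second kind, $U_j(\cos t)=\sin((j+1)t)/\sin t$, and $U_j'$ is its derivative. The rational functions in the compact forms have only removable singularities, and are understood as the polynomials obtained after removing them. For even $N$ and $1\le k\le N/2$: $$z_{2k-1}^{(1)}(x)=U_{k-1}(x)^2-R_N(x)\big(U_{2k-1}(x)+2k\big),\qquad z_{2k}^{(1)}(x)=U_{k-1}(x)U_k(x)-R_N(x)\big(U_{2k}(x)-2k-1\big),$$ $$R_N(x)=\frac{(N+2)(N+4)}{4(N+3)}\cdot\frac1{q_N(x)^2-1},\qquad q_N(x)=\frac{N+2}{2U_{N/2}(x)}.$$ *)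

(* Defs.v *)
From HB Require Import structures.
From mathcomp Require Import all_boot all_order all_algebra complex ring.
From mathcomp Require Import all_classical all_reals all_analysis.

Set Implicit Arguments.
Unset Strict Implicit.
Unset Printing Implicit Defensive.

Import Order.TTheory GRing.Theory Num.Theory numFieldNormedType.Exports.

Local Open Scope ring_scope.

(* [R[i]^o] carries the topology of the norm |.| on the complex numbers, and
   derivability in the direction 1 over the scalars R[i] is complex
   differentiability. *)
Definition holomorphic_on_disk (R : realType) (F : R[i] -> R[i]) : Prop :=
  forall z : R[i], `|z| < 1 -> derivable (F : R[i]^o -> R[i]^o) z 1.

Definition typically_real (R : realType) (F : R[i] -> R[i]) : Prop :=
  [/\ holomorphic_on_disk F,
      forall z : R[i], `|z| < 1 -> z \is Num.real -> F z \is Num.real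
    & forall z : R[i], `|z| < 1 -> z \isn't Num.real ->
        0 < complex.Im (F z) * complex.Im z].

Definition chorner (R : realType) (P : {poly R}) (z : R[i]) : R[i] :=
  (map_poly (real_complex R) P).[z].

Definition typically_real_poly (R : realType) (N : nat) (P : {poly R}) : Prop :=
  (exists a : nat -> R, P = 'X + \sum_(2 <= j < N.+1) a j *: 'X^j)
  /\ typically_real (chorner P).

Definition upper_extremizer (R : realType) (N : nat) (B : R) (P : {poly R}) :
  Prop := typically_real_poly N P /\ P`_2 = B.

Definition lower_extremizer (R : realType) (N : nat) (B : R) (P : {poly R}) :
  Prop := typically_real_poly N P /\ P`_2 = - B.

Definition negate_even_coefs (R : realType) (P : {poly R}) : {poly R} :=
  \poly_(j < size P) (if odd j then P`_j else - P`_j).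

Definition smallest_positive_root (R : realType) (p : {poly R}) (x : R) : Prop :=
  [/\ 0 < x, root p x & forall y, 0 < y -> root p y -> x <= y].

Definition maximal_root (R : realType) (p : {poly R}) (x : R) : Prop :=
  root p x /\ forall y, root p y -> y <= x.

(* The Chebyshev polynomials of the second kind; see [chebUE]. *)
Fixpoint chebU (R : realType) (n : nat) : {poly R} :=
  match n with
  | 0 => 1
  | 1 => 2 * 'X
  | (m.+1 as n').+1 => 2 * 'X * chebU R n' - chebU R m
  end.

Lemma chebUE (R : realType) (n : nat) (t : R) : sin t != 0 ->
  (chebU R n).[cos t] = sin (n.+1%:R * t) / sin t.
Proof.
move=> st.
have two : (2 : {poly R}) = 2%:P by rewrite -[2]/(1%:P *+ 2) -polyCMn.
suff [] : (chebU R n).[cos t] = sin (n.+1%:R * t) / sin t /\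
  (chebU R n.+1).[cos t] = sin (n.+2%:R * t) / sin t by [].
elim: n => [|n [IH1 IH2]].
  split; first by rewrite /= hornerC mul1r divff.
  rewrite /= two !hornerE [2%:R * t]mulr_natl mulr2n sinD.
  by apply: (mulIf st); rewrite mulfVK //; ring.
split=> //.
rewrite [chebU R n.+2]/= -/(chebU R n.+1) two.
rewrite hornerD hornerN hornerM hornerM hornerC hornerX IH1 IH2.
have e3 : n.+3%:R * t = n.+2%:R * t + t by rewrite -[n.+3]addn1 natrD; ring.
have e1 : n.+1%:R * t = n.+2%:R * t - t by rewrite -[n.+2]addn1 natrD; ring.
rewrite e3 e1 sinB sinD.
by apply: (mulIf st); rewrite mulrBl mulrA !mulfVK //; ring.
Qed.

Section OddDegree.
Variables (R : realType) (N : nat).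

Local Notation U j x := (chebU R j).[x].

Definition theta : R := 2 * pi / (N%:R + 3).

Definition mu : R := cos theta.

Definition odd_coef_odd_index (j : nat) : R :=
  2 / (N%:R + 3) *
  (mu * U j.-1 mu * U j mu
   + ((N%:R + 3) / 2 - j%:R) * (U j mu) ^+ 2
   - ((N%:R + 1) / 2 - j%:R) * (U j.-1 mu) ^+ 2).

Definition odd_coef_even_index (j : nat) : R :=
  4 / (N%:R + 3) * U j.-1 mu *
  (((N%:R + 3) / 2 - j%:R) * U j mu
   - mu * ((N%:R + 1) / 2 - j%:R) * U j.-1 mu).

Definition odd_compact (z : R[i]) : R[i] :=
  let c := real_complex R (cos theta) in
  let s := real_complex R (sin theta) in
  z / (1 - 2 * z * c + z ^+ 2)
  + 4 / (N%:R + 3) * s ^+ 2 * (z ^+ 3 / (1 - z ^+ 2))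
    * ((1 - z ^+ (N + 3)) / (1 - 2 * z * c + z ^+ 2) ^+ 2).

End OddDegree.

Section EvenDegree.
Variables (R : realType) (N : nat).

Local Notation U j x := (chebU R j).[x].

Definition qN (x : R) : R := (N%:R + 2) / (2 * U N./2 x).

Definition RN (x : R) : R :=
  (N%:R + 2) * (N%:R + 4) / (4 * (N%:R + 3)) * (1 / ((qN x) ^+ 2 - 1)).

(* [z1_odd x k] and [z1_even x k] are the entries of index 2k-1 and 2k. *)
Definition z1_odd (x : R) (k : nat) : R :=
  (U k.-1 x) ^+ 2 - RN x * (U (2 * k - 1)%N x + 2 * k%:R).

Definition z1_even (x : R) (k : nat) : R :=
  U k.-1 x * U k x - RN x * (U (2 * k)%N x - 2 * k%:R - 1).

Definition z1 (x : R) (k : nat) : R :=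
  if odd k then z1_odd x k.+1./2 else z1_even x k./2.

(* The sum is over 1 <= k <= N - s + 1, hence empty for s = N + 1, N + 2. *)
Definition gamma (x : R) (s : nat) : R :=
  \sum_(1 <= k < N.+2 - s) z1 x k * z1 x (k + s - 1)%N.

Definition even_coef (eta : R) (s : nat) : R :=
  (gamma eta s - gamma eta (s + 2)) / (gamma eta 1 - gamma eta 3).

Definition gamma1_star (eta : R) : R := 2 * (1 - eta).

Definition gamma2_star (eta : R) : R :=
  2 / (N%:R + 3) * (- 2 * eta ^+ 2 - 2 * (N%:R + 3) * eta + N%:R + 5).

Definition QN (eta : R) : R :=
  2 * (1 - eta ^+ 2) / ((N%:R + 2) * (N%:R + 3) * (N%:R + 4)).

Definition hN (z : R[i]) : R[i] :=
  ((N%:R + 4) / 2) ^+ 2 * (1 - z ^+ (N + 2))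
  + ((N%:R + 2) / 2) ^+ 2 * (1 - z ^+ (N + 4))
  + (N%:R + 2) * (N%:R + 4) / 2 * (z - z ^+ (N + 3)).

Definition even_compact (eta : R) (z : R[i]) : R[i] :=
  let e := real_complex R eta in
  let g1 := real_complex R (gamma1_star eta) in
  let g2 := real_complex R (gamma2_star eta) in
  let Q := real_complex R (QN eta) in
  (z + z ^+ 5 + g1 * (z ^+ 2 + z ^+ 4) + g2 * z ^+ 3)
    / ((1 + z) ^+ 2 * (z ^+ 2 + 1 - 2 * e * z) ^+ 2)
  + Q * (8 * z ^+ 4 * hN z
    / ((1 - z) * (1 + z) ^+ 3 * (z ^+ 2 + 1 - 2 * e * z) ^+ 2)).

End EvenDegree.

(* Main.v *)
Require Import Defs.
From HB Require Import structures.
From mathcomp Require Import all_boot all_order all_algebra complex polyrcf ring lra zify.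
From mathcomp Require Import all_classical all_reals all_analysis.
Import Order.TTheory GRing.Theory Num.Theory numFieldNormedType.Exports.
Local Open Scope ring_scope.

Set Implicit Arguments.
Unset Strict Implicit.
Unset Printing Implicit Defensive.

(** Write $S_j=U_{j-1}$, so that $S_j(\cos t)\sin t=\sin jt$. A real polynomial
    $P(z)=\sum_j a_jz^j$ satisfies $\Im P(e^{it})=p(\cos t)\sin t$ with
    $p=\sum_j a_jS_j$, called its profile below. Radial limits show that
    $p\ge 0$ on $[-1,1]$ when P is typically real. Conversely $\Im P$ inside the
    disk is recovered from p by a Poisson formula; it is used here in the
    discrete form given by the sine transform with M nodes, whose kernel is
    positive once M is large ([kernel_gt0], [Im_chorner_gt0]). So the problem is
    to maximize $a_2$ among the profiles $p\ge 0$ with $a_1=1$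
    ([typically_real_polyP]).

    With $L(f)=\frac2\pi\int_{-1}^1 f(x)\sqrt{1-x^2}\,dx$ one has $a_1=L(p)$ and
    $a_2=L(2xp)$. A Gauss quadrature formula with positive weights and nodes
    $x_i\le\lambda$, exact up to degree N, gives
    $2\lambda-a_2=\sum_i w_i\,2(\lambda-x_i)p(x_i)\ge 0$ ([gauss_le]). Equality
    forces p to vanish at the nodes other than $\lambda$, to second order at
    those in $(-1,1)$, and this determines p ([gauss_extremal_uniq]). For
    $N=2n-1$ the nodes are the zeros of $U_n$ and the largest is
    $\cos\frac{\pi}{n+1}=\mu_N$. For $N=2n$ the degree of p is odd and the end
    point $-1$ has to be a node: the node polynomial is
    $(n+1)U_{n+1}+(n+2)U_n=(1+x)(U_{n+1}-U_n)'$ ([radauE]), whose zeros interlace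
    with those of $U_n$ and whose largest zero is $\eta_N$. The substitution
    $x=1-2y^2$ turns $U_{n+1}-U_n$ into $\pm U_{2n+2}(y)$, which relates
    $\eta_N$ to $\nu_N$ ([nu_eta]). Replacing $P(z)$ by $-P(-z)$ reflects the
    profile and exchanges the upper and the lower bound.

    It remains to recognize the polynomials of the statement as the extremal
    ones, that is, to see that their profiles are multiples of
    $(U_n/(x-\mu_N))^2$, respectively $(1+x)((U_{n+1}-U_n)'/(x-\eta_N))^2$. The
    identities for profiles are checked at real $z>1$ through
    $S_j(\frac{z+1/z}2)(z-\frac1z)=z^j-z^{-j}$. For odd N the coefficients
    satisfy a linear recurrence, so partial sums of $\sum_s a_sz^s$ times the
    denominator of the compact form telescope; this proves the compact form, and
    its imaginary part on the circle is the profile ([odd_profile_poly]). For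
    even N the coefficients are differences of autocorrelations, so the profile
    is proportional to $|\sum_k z_k^{(1)}e^{ikt}|^2$
    ([autocorrelation_profile]), and the same telescoping sums
    $\sum_k z_k^{(1)}z^k$. The compact form then follows from the profile: P
    times the denominator is determined by $P(z)-P(1/z)$ up to two constants
    ([antisymmetric_poly_eq0]), and these come from the zeros of the denominator
    at $-1$ and $\eta_N$. *)


(** * Polynomials over the reals *)

Section RealPolynomials.
Variable R : realType.
Implicit Types (p q f g : {poly R}) (x y z : R).

Lemma two_polyC : (2 : {poly R}) = 2%:P.
Proof. by rewrite -[2]/(1%:P *+ 2) -polyCMn. Qed.

Lemma poly_eq0_of_natpoints p : (forall k, p.[k.+2%:R] = 0) -> p = 0.
Proof.
move=> p0; apply/eqP; apply: contraT => nz.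
have := max_poly_roots nz (rs := [seq k.+2%:R | k <- iota 0 (size p)]).
rewrite size_map size_iota ltnn; apply.
  by apply/allP => _ /mapP[k _ ->]; apply/rootP.
by rewrite map_inj_uniq ?iota_uniq // => i j /eqP; rewrite eqr_nat => /eqP[].
Qed.

Lemma poly_ext_gt1 p q : (forall x, 1 < x -> p.[x] = q.[x]) -> p = q.
Proof.
move=> pq; apply/eqP; rewrite -subr_eq0; apply/eqP.
apply: poly_eq0_of_natpoints => k.
by rewrite hornerD hornerN pq ?subrr // ltr1n.
Qed.

(** By continuity; this serves for radial limits and for the end points of
    [-1, 1]. *)
Lemma horner_ge0_right p x y : x < y ->
  (forall z, x < z < y -> 0 <= p.[z]) -> 0 <= p.[y].
Proof.
move=> xy p_ge0; rewrite leNgt; apply/negP => py0.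
have [|d d0 dP] := poly_cont y p (e := - p.[y]); first by rewrite oppr_gt0.
pose e := Num.min (d / 2) ((y - x) / 2).
have e0 : 0 < e by rewrite lt_min; apply/andP; split; lra.
have ed : e <= d / 2 by rewrite ge_min lexx.
have ey : e <= (y - x) / 2 by rewrite ge_min lexx orbT.
have /p_ge0 : x < y - e < y by apply/andP; split; lra.
have : `|y - e - y| < d by rewrite addrC addKr normrN gtr0_norm; lra.
move/dP; rewrite ltr_norml => /andP[_]; lra.
Qed.

Lemma horner_ge0_left p x y : x < y ->
  (forall z, x < z < y -> 0 <= p.[z]) -> 0 <= p.[x].
Proof.
move=> xy p_ge0.
have := @horner_ge0_right (p \Po (- 'X)) (- y) (- x).
rewrite !horner_comp !hornerE opprK; apply; first by rewrite ltrN2.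
move=> z /andP[z1 z2]; rewrite horner_comp !hornerE; apply: p_ge0.
by apply/andP; split; lra.
Qed.

(** A polynomial that stays nonnegative around one of its zeros is tangent to
    the axis there. *)
Lemma deriv_eq0_of_ge0 p a b x : a < x < b -> root p x ->
  (forall z, a < z < b -> 0 <= p.[z]) -> p^`().[x] = 0.
Proof.
move=> /andP[ax xb] /factor_theorem[q ->] p_ge0.
rewrite derivM derivXsubC mulr1 hornerD hornerM hornerXsubC subrr mulr0 add0r.
have q_ge0 : 0 <= q.[x].
  apply: (@horner_ge0_left _ _ b) => // z /andP[z1 z2].
  have := p_ge0 z; rewrite z2 (lt_trans ax z1) hornerM hornerXsubC => /(_ isT).
  by rewrite pmulr_lge0 // subr_gt0.
have q_le0 : 0 <= (- q).[x].
  apply: (@horner_ge0_right _ a) => // z /andP[z1 z2].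
  have := p_ge0 z; rewrite z1 (lt_trans z2 xb) hornerM hornerXsubC => /(_ isT).
  by rewrite nmulr_lge0 ?subr_lt0 // hornerN oppr_ge0.
by apply/eqP; rewrite eq_le q_ge0 andbT -oppr_ge0 -hornerN.
Qed.

End RealPolynomials.

(** * Chebyshev polynomials and the discrete sine transform *)

(** [chebS j] is $U_{j-1}$, with $U_{-1} = 0$; it satisfies
    $S_j(\cos t)\sin t = \sin jt$ for every j, including j = 0. *)
Definition chebS (R : realType) (j : nat) : {poly R} :=
  if j is i.+1 then chebU R i else 0.

Section Chebyshev.
Variable R : realType.
Implicit Types (p q f g : {poly R}) (x y z t : R).

Local Notation S := (chebS R).

Lemma chebS0 : S 0 = 0. Proof. by []. Qed.
Lemma chebS1 : S 1 = 1. Proof. by []. Qed.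

Lemma chebS_rec j : S j.+2 = 2 * 'X * S j.+1 - S j.
Proof. by case: j => [|j]; rewrite /= ?mulr1 ?subr0. Qed.

Lemma horner_chebS_rec j x : (S j.+2).[x] = 2 * x * (S j.+1).[x] - (S j).[x].
Proof. by rewrite chebS_rec two_polyC !hornerE. Qed.

Lemma size_chebS j : (0 < j)%N -> size (S j) = j /\ 0 < lead_coef (S j).
Proof.
case: j => // j _; elim: j {-2}j (leqnn j) => [|m IH] [|[|j]] // jm;
  rewrite ?chebS1 ?size_poly1 ?lead_coef1 //.
  rewrite chebS_rec chebS0 chebS1 subr0 mulr1 two_polyC mul_polyC.
  by rewrite size_scale ?size_polyX ?lead_coefZ ?lead_coefX ?mulr1.
have [|s1 l1] := IH j.+1; first by lia.
have [|s0 l0] := IH j; first by lia.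
have nz : S j.+2 != 0 by rewrite -lead_coef_eq0 gt_eqF.
have sX : size (2 * 'X * S j.+2) = j.+3.
  rewrite two_polyC -mulrA mul_polyC size_scale ?pnatr_eq0 //.
  by rewrite mulrC size_mulX // s1.
rewrite chebS_rec; split; first by rewrite size_polyDl ?sX // size_polyN s0.
rewrite lead_coefDl ?size_polyN ?sX ?s0 //.
by rewrite two_polyC -mulrA mul_polyC lead_coefZ lead_coefM lead_coefX mul1r mulr_gt0.
Qed.

Lemma chebS_trig j t : (S j).[cos t] * sin t = sin (j%:R * t).
Proof.
suff [] : (S j).[cos t] * sin t = sin (j%:R * t) /\
          (S j.+1).[cos t] * sin t = sin (j.+1%:R * t) by [].
elim: j => [|j [IH1 IH2]]; first by rewrite horner0 hornerC !mul0r mul1r sin0 mul1r.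
split=> //; rewrite horner_chebS_rec mulrBl IH1 -[_ * _ * _ * _]mulrA IH2.
have -> : j.+2%:R * t = j.+1%:R * t + t by rewrite -[j.+2]addn1 natrD; ring.
have -> : j%:R * t = j.+1%:R * t - t by rewrite -[j.+1]addn1 natrD; ring.
by rewrite sinB sinD; ring.
Qed.

(** The identity $\sin jt = S_j(\cos t)\sin t$ off the unit circle. *)
Lemma chebS_joukowski j z : z != 0 ->
  (S j).[(z + z^-1) / 2] * (z - z^-1) = z ^+ j - z^-1 ^+ j.
Proof.
move=> z0.
suff [] : (S j).[(z + z^-1) / 2] * (z - z^-1) = z ^+ j - z^-1 ^+ j /\
  (S j.+1).[(z + z^-1) / 2] * (z - z^-1) = z ^+ j.+1 - z^-1 ^+ j.+1 by [].
elim: j => [|j [IH1 IH2]].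
  by rewrite horner0 hornerC mul0r mul1r !expr0 !expr1 subrr.
split=> //; rewrite horner_chebS_rec mulrBl IH1 -[_ * _ * _ * _]mulrA IH2 !exprS.
by field.
Qed.

(** The first integral of the recurrence, $\sin^2 jt+\sin^2(j+1)t
    -2\cos t\sin jt\sin(j+1)t=\sin^2 t$. *)
Lemma chebS_invariant j x :
  (S j).[x] ^+ 2 + (S j.+1).[x] ^+ 2 - 2 * x * (S j).[x] * (S j.+1).[x] = 1.
Proof.
elim: j => [|j IH]; first by rewrite chebS0 chebS1 horner0 hornerC; ring.
by rewrite -[RHS]IH horner_chebS_rec; ring.
Qed.

Lemma chebS_opp j x : (S j).[- x] = (-1) ^+ j.+1 * (S j).[x].
Proof.
suff [] : (S j).[- x] = (-1) ^+ j.+1 * (S j).[x] /\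
   (S j.+1).[- x] = (-1) ^+ j.+2 * (S j.+1).[x] by [].
elim: j => [|j [IH1 IH2]]; first by rewrite !horner0 !hornerC; split; ring.
by split=> //; rewrite !horner_chebS_rec IH1 IH2 !exprS; ring.
Qed.

Lemma chebS_at1 j : (S j).[1] = j%:R.
Proof.
suff [] : (S j).[1] = j%:R /\ (S j.+1).[1] = j.+1%:R by [].
elim: j => [|j [IH1 IH2]]; first by rewrite horner0 hornerC.
by split=> //; rewrite horner_chebS_rec IH1 IH2 -[j.+2]addn1 -[j.+1]addn1 !natrD; ring.
Qed.

Lemma cos_npi j : cos (j%:R * pi) = (-1) ^+ j :> R.
Proof.
elim: j => [|j IH]; first by rewrite mul0r cos0.
by rewrite -addn1 natrD mulrDl mul1r cosDpi IH exprD expr1 mulrN1.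
Qed.

Lemma sin_npi j : sin (j%:R * pi) = 0 :> R.
Proof.
elim: j => [|j IH]; first by rewrite mul0r sin0.
by rewrite -addn1 natrD mulrDl mul1r sinDpi IH oppr0.
Qed.

Definition node (M k : nat) : R := k%:R * pi / M%:R.

Lemma node_itv M k : (0 < k < M)%N -> 0 < node M k < pi.
Proof.
move=> /andP[k0 kM]; have M0 : 0 < M%:R :> R by rewrite ltr0n; lia.
apply/andP; split; first by rewrite /node divr_gt0 ?mulr_gt0 ?pi_gt0 ?M0 ?ltr0n.
by rewrite ltr_pdivrMr // mulrC ltr_pM2l ?pi_gt0 // ltr_nat.
Qed.

Lemma sin_node_gt0 M k : (0 < k < M)%N -> 0 < sin (node M k).
Proof. by move=> /node_itv/sin_gt0_pi. Qed.

Lemma cos_node_lt M i j : (i < j <= M)%N -> cos (node M j) < cos (node M i).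
Proof.
move=> /andP[ij jM]; have M0 : 0 < M%:R :> R by rewrite ltr0n; lia.
have itv k : (k <= M)%N -> node M k \in `[0, pi].
  move=> kM; rewrite in_itv /=; apply/andP; split.
    by rewrite /node divr_ge0 ?mulr_ge0 ?pi_ge0 ?ler0n.
  by rewrite ler_pdivrMr // mulrC ler_pM2l ?pi_gt0 // ler_nat.
rewrite ltr_cos ?itv //; last by lia.
by rewrite /node ltr_pM2r ?invr_gt0 // ltr_pM2r ?pi_gt0 // ltr_nat.
Qed.

Lemma cos_node_itv M k : (0 < k < M)%N -> -1 < cos (node M k) < 1.
Proof.
move=> /andP[k0 kM]; have M0 : M%:R != 0 :> R by rewrite pnatr_eq0; lia.
have := @cos_node_lt M 0 k; rewrite k0 ltnW // => /(_ isT).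
have := @cos_node_lt M k M; rewrite kM leqnn => /(_ isT).
by rewrite {1 4}/node mul0r mul0r cos0 mulrAC divff // mul1r cospi => -> ->.
Qed.

Lemma cos_node_inj M i j : (i <= M)%N -> (j <= M)%N ->
  cos (node M i) = cos (node M j) -> i = j.
Proof.
move=> iM jM e; have [ij|ij|//] := ltngtP i j.
  by have := @cos_node_lt M i j; rewrite ij jM e ltxx => /(_ isT).
by have := @cos_node_lt M j i; rewrite ij iM e ltxx => /(_ isT).
Qed.

Lemma muln_node M k : (0 < M)%N -> M%:R * node M k = k%:R * pi.
Proof. by move=> M0; rewrite /node; field; rewrite pnatr_eq0 -lt0n. Qed.

Lemma chebS_node M k : (0 < k < M)%N -> (S M).[cos (node M k)] = 0.
Proof.
move=> kM; have s0 := sin_node_gt0 kM; have M0 : (0 < M)%N by lia.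
have : (S M).[cos (node M k)] * sin (node M k) = 0.
  by rewrite chebS_trig muln_node // sin_npi.
by move/eqP; rewrite mulf_eq0 (gt_eqF s0) orbF => /eqP.
Qed.

Lemma chebS_node_succ M k : (0 < k < M)%N ->
  (S M.+1).[cos (node M k)] = (-1) ^+ k.
Proof.
move=> kM; have s0 := sin_node_gt0 kM; have M0 : (0 < M)%N by lia.
apply: (mulIf (lt0r_neq0 s0)); rewrite chebS_trig -[M.+1]addn1 natrD mulrDl mul1r.
by rewrite muln_node // sinD sin_npi cos_npi mul0r add0r.
Qed.

(** Multiplied by $2\sin(j\pi/2M)$, the sum telescopes. Only the parity of j
    enters, so for distinct i and j the sums for i - j and i + j cancel in
    [sinquad_chebSM]. *)
Lemma sum_cos_node M j : (0 < j < 2 * M)%N ->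
  \sum_(k < M) cos (j%:R * node M k) = (odd j)%:R.
Proof.
move=> /andP[j0 jM]; have M0 : M%:R != 0 :> R by rewrite pnatr_eq0; lia.
pose h : R := j%:R * pi / (2 * M%:R).
have s0 : sin h != 0.
  apply/lt0r_neq0/sin_gt0_pi; rewrite /h divr_gt0 ?mulr_gt0 ?pi_gt0 ?ltr0n //; last lia.
  rewrite ltr_pdivrMr; last by rewrite -natrM ltr0n; lia.
  by rewrite mulrC ltr_pM2l ?pi_gt0 // -natrM ltr_nat.
have E k : j%:R * node M k = k%:R * (2 * h) by rewrite /node /h; field.
have tele m : 2 * sin h * (\sum_(k < m) cos (k%:R * (2 * h))) =
              sin (m%:R * (2 * h) - h) + sin h.
  elim: m => [|m IH].
    by rewrite big_ord0 mulr0 mul0r add0r sinN addNr.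
  rewrite big_ord_recr /= mulrDr IH.
  have -> : m.+1%:R * (2 * h) - h = m%:R * (2 * h) + h.
    by rewrite -[m.+1]addn1 natrD; ring.
  by rewrite sinB sinD; ring.
apply: (mulfI (mulf_neq0 (_ : 2 != 0) s0)); first by rewrite pnatr_eq0.
under eq_bigr => k _ do rewrite E.
rewrite tele.
have -> : M%:R * (2 * h) = j%:R * pi by rewrite /h; field.
rewrite sinB sin_npi cos_npi mul0r sub0r -signr_odd.
by case: (odd j); rewrite /= ?expr0 ?expr1; ring.
Qed.

(** ** Quadrature at the nodes of the sine transform *)

(** The functional $\frac2\pi\int_{-1}^1 f(x)\sqrt{1-x^2}\,dx$, discretized at
    the nodes $\cos(k\pi/M)$; it is exact on polynomials of low degree. *)
Definition sinquad (M : nat) (f : {poly R}) : R :=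
  2 / M%:R * \sum_(k < M) f.[cos (node M k)] * sin (node M k) ^+ 2.

Lemma sinquad_is_scalar M : scalar (sinquad M).
Proof.
move=> c p q; rewrite /sinquad /= mulrCA -mulrDr; congr (_ * _).
rewrite mulr_sumr -big_split /=; apply: eq_bigr => k _.
by rewrite hornerD hornerZ mulrDl -mulrA.
Qed.

HB.instance Definition _ M :=
  GRing.isLinear.Build R {poly R} R *%R (sinquad M) (sinquad_is_scalar M).

Lemma sinquad_chebSM M i j : (0 < i)%N -> (0 < j)%N -> (i + j < 2 * M)%N ->
  sinquad M (S i * S j) = (i == j)%:R.
Proof.
wlog ij : i j / (i <= j)%N.
  move=> wl i0 j0 ijM; have [ij|/ltnW ij] := leqP i j; first exact: wl.
  by rewrite mulrC eq_sym wl // addnC.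
move=> i0 j0 ijM; have M0 : M%:R != 0 :> R by rewrite pnatr_eq0; lia.
have E (k : 'I_M) : true -> (S i * S j).[cos (node M k)] * sin (node M k) ^+ 2 =
    (cos ((j - i)%N%:R * node M k) - cos ((i + j)%N%:R * node M k)) / 2.
  move=> _; transitivity (sin (i%:R * node M k) * sin (j%:R * node M k)).
    by rewrite -!chebS_trig hornerM; ring.
  rewrite natrB // natrD [(_ - _) * node M k]mulrBl [(_ + _) * node M k]mulrDl.
  by rewrite cosB cosD; field.
rewrite /sinquad (eq_bigr _ E) -mulr_suml sumrB [X in _ - X]sum_cos_node; last by lia.
have [eij|nij] := eqVneq i j; last first.
  rewrite sum_cos_node; last by lia.
  by rewrite oddB // addbC -oddD addnC subrr mul0r mulr0.
rewrite -eij subnn addnn odd_double /= subr0.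
rewrite (eq_bigr (fun=> 1)); last by move=> k _; rewrite mul0r cos0.
by rewrite sumr_const card_ord; rewrite ?eqxx /=; field.
Qed.

Lemma sinquad_chebS M j : (0 < j)%N -> (j.+1 < 2 * M)%N ->
  sinquad M (S j) = (j == 1)%:R.
Proof.
by move=> j0 jM; rewrite -[S j]mul1r -chebS1 sinquad_chebSM // eq_sym.
Qed.

Lemma sinquad_ge0 M p : (forall x, -1 < x < 1 -> 0 <= p.[x]) -> 0 <= sinquad M p.
Proof.
move=> p_ge0; rewrite /sinquad mulr_ge0 ?divr_ge0 ?ler0n // sumr_ge0 // => -[k kM] _ /=.
have [k0|k0] := posnP k; first by rewrite k0 /node !mul0r sin0 expr0n mulr0.
by rewrite mulr_ge0 ?sqr_ge0 // p_ge0 // cos_node_itv // k0.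
Qed.

(** A polynomial of low degree cannot vanish at all the nodes. *)
Lemma sinquad_gt0 M p : p != 0 -> (size p < M)%N ->
  (forall x, -1 < x < 1 -> 0 <= p.[x]) -> 0 < sinquad M p.
Proof.
move=> p0 pM p_ge0; rewrite lt0r sinquad_ge0 // andbT.
apply/eqP => /eqP; rewrite /sinquad mulf_eq0 mulf_eq0 pnatr_eq0 invr_eq0 pnatr_eq0 /=.
have -> /= : (M == 0)%N = false by lia.
have p_node (k : 'I_M) : (0 < k)%N -> 0 <= p.[cos (node M k)].
  by case: k => k kM /= k0; rewrite p_ge0 // cos_node_itv // k0.
rewrite psumr_eq0; last first.
  move=> k _; have [k0|k0] := posnP k.
    by rewrite k0 /node !mul0r sin0 expr0n mulr0.
  by rewrite mulr_ge0 ?sqr_ge0 ?p_node.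
move/allP => h; have pM' : (size p <= M.-1)%N by lia.
suff : p = 0 by move/eqP; rewrite (negbTE p0).
apply: (@roots_geq_poly_eq0 _ _ [seq cos (node M k) | k <- iota 1 M.-1]).
- apply/allP => _ /mapP[k + ->]; rewrite mem_iota => /andP[k0 kM].
  have kM' : (k < M)%N by lia.
  have /= := h (Ordinal kM') (mem_index_enum _).
  by rewrite mulf_eq0 sqrf_eq0 (gt_eqF (sin_node_gt0 _)) ?orbF ?k0.
- rewrite map_inj_in_uniq ?iota_uniq // => i j; rewrite !mem_iota => iM jM.
  by apply: cos_node_inj; lia.
- by rewrite size_map size_iota.
Qed.

End Chebyshev.

Arguments chebS : simpl never.

(** * Gauss quadrature and the extremal problem *)

Section GaussQuadrature.
Variables (R : realType) (L : {scalar {poly R}}) (xs : seq R) (k : nat).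
Implicit Types (f g p q : {poly R}) (x y : R).
Hypothesis xs_uniq : uniq xs.
Hypothesis size_xs : (size xs <= k.+1)%N.
Hypothesis L_sqr_gt0 :
  forall p : {poly R}, p != 0 -> (size p <= size xs)%N -> 0 < L (p ^+ 2).

Let omega : {poly R} := \prod_(x <- xs) ('X - x%:P).

Hypothesis L_orth : forall g : {poly R}, (size g <= k)%N -> L (omega * g) = 0.

Let lag (x : R) : {poly R} := \prod_(y <- rem x xs) ('X - y%:P).

Let weight (x : R) : R := L (lag x ^+ 2) / (lag x).[x] ^+ 2.

Let lag_neq0 x : x \in xs -> (lag x).[x] != 0.
Proof.
move=> xxs; rewrite -[_ == 0]/(root (lag x) x) root_prod_XsubC.
by rewrite mem_rem_uniq // inE eqxx.
Qed.

Let lag_eq0 x y : y \in xs -> y != x -> (lag x).[y] = 0.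
Proof.
move=> yxs yx; apply/rootP; rewrite root_prod_XsubC mem_rem_uniq //.
by rewrite inE yx.
Qed.

Let size_lag x : x \in xs -> size (lag x) = size xs.
Proof.
move=> xxs; rewrite size_prod_XsubC size_rem // prednK //.
by case: xs xxs.
Qed.

Let weight_gt0 x : x \in xs -> 0 < weight x.
Proof.
move=> xxs; have nz := lag_neq0 xxs.
rewrite divr_gt0 //; last by rewrite lt0r sqrf_eq0 nz sqr_ge0.
apply: L_sqr_gt0; last by rewrite size_lag.
by apply: contraNneq nz => ->; rewrite horner0.
Qed.

Let omega_factor f : (forall x, x \in xs -> f.[x] = 0) ->
  (size f <= size xs + k)%N -> exists2 g : {poly R}, f = omega * g & (size g <= k)%N.
Proof.
move=> f0 sf; have [g fE] : exists g : {poly R}, f = g * omega.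
  apply: uniq_roots_prod_XsubC; last by rewrite uniq_rootsE.
  by apply/allP => x /f0/rootP.
exists g; first by rewrite mulrC.
have [->|g0] := eqVneq g 0; first by rewrite size_poly0.
move: sf; rewrite fE size_Mmonic ?monic_prod_XsubC //.
by rewrite size_prod_XsubC => sf'; lia.
Qed.

(** The interpolation of f at the nodes uses the squares of the Lagrange
    polynomials, which makes the positivity of the weights manifest. *)
Let gauss_quadrature f : (size f <= size xs + k)%N ->
  L f = \sum_(x <- xs) weight x * f.[x].
Proof.
move=> sf.
pose i := \sum_(x <- xs) (f.[x] / (lag x).[x] ^+ 2) *: lag x ^+ 2.
have fi x : x \in xs -> (f - i).[x] = 0.
  move=> xxs; rewrite hornerD hornerN horner_sum (bigD1_seq x) //=.
  rewrite hornerZ horner_exp mulfVK ?sqrf_eq0 ?lag_neq0 //.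
  rewrite big_seq_cond big1 ?addr0 ?subrr // => y /andP[yxs yx].
  by rewrite hornerZ horner_exp (lag_eq0 xxs) ?expr0n ?mulr0 // eq_sym.
have si : (size i <= size xs + k)%N.
  apply: (leq_trans (size_sum _ _ _)); apply/bigmax_leqP_seq => x xxs _.
  apply: (leq_trans (size_scale_leq _ _)).
  apply: (leq_trans (size_poly_exp_leq _ _)).
  have : (0 < size xs)%N by rewrite lt0n size_eq0; apply: contraTneq xxs => ->.
  by rewrite size_lag //; lia.
have [|g fE sg] := omega_factor fi.
  apply: (leq_trans (size_polyD _ _)); rewrite size_polyN geq_max sf.
  exact: si.
have /eqP := L_orth sg; rewrite -fE linearB subr_eq0 => /eqP ->.
rewrite linear_sum; apply: eq_bigr => x _.
by rewrite linearZ /= /weight; ring.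
Qed.

Variable lam : R.
Hypothesis lam_xs : lam \in xs.
Hypothesis xs_itv : forall x, x \in xs -> -1 <= x <= 1.
Hypothesis xs_max : forall x, x \in xs -> x <= lam.

Let quadB p : ((size p).+1 <= size xs + k)%N ->
  2 * lam * L p - L (2 * 'X * p) =
  \sum_(x <- xs) weight x * (2 * (lam - x) * p.[x]).
Proof.
move=> sp; transitivity (L ((2 * (lam%:P - 'X)) * p)).
  rewrite -[2 * lam * _]linearZ -linearB; congr (L _).
  by rewrite -mul_polyC two_polyC polyCM; ring.
rewrite gauss_quadrature.
  by apply: eq_bigr => x _; rewrite two_polyC !hornerE.
apply: (leq_trans (size_polyMleq _ _)).
have : (size (2 * (lam%:P - 'X) : {poly R})%R <= 2)%N.
  rewrite two_polyC mul_polyC (leq_trans (size_scale_leq _ _)) //.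
  by rewrite -opprB size_polyN size_XsubC.
lia.
Qed.

Let term_ge0 p x : (forall x, -1 <= x <= 1 -> 0 <= p.[x]) -> x \in xs ->
  0 <= weight x * (2 * (lam - x) * p.[x]).
Proof.
move=> p_ge0 xxs; rewrite mulr_ge0 ?(ltW (weight_gt0 _)) //.
by rewrite mulr_ge0 ?p_ge0 ?xs_itv // mulr_ge0 ?subr_ge0 ?xs_max.
Qed.

(** The gap is a sum of nonnegative terms over the nodes. *)
Lemma gauss_le p : ((size p).+1 <= size xs + k)%N ->
  (forall x, -1 <= x <= 1 -> 0 <= p.[x]) -> L (2 * 'X * p) <= 2 * lam * L p.
Proof.
move=> sp p_ge0; rewrite -subr_ge0 quadB // big_seq sumr_ge0 // => x xxs.
exact: term_ge0.
Qed.

(** In case of equality only the node lam can carry mass. *)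
Lemma gauss_eq0 p x : ((size p).+1 <= size xs + k)%N ->
  (forall x, -1 <= x <= 1 -> 0 <= p.[x]) -> L (2 * 'X * p) = 2 * lam * L p ->
  x \in xs -> x != lam -> p.[x] = 0.
Proof.
move=> sp p_ge0 /eqP; rewrite eq_sym -subr_eq0 quadB // big_seq_cond.
rewrite psumr_eq0; last by move=> y /andP[yxs _]; exact: term_ge0.
move=> /allP h xxs xl; have := h x xxs; rewrite xxs /=.
rewrite mulf_eq0 (gt_eqF (weight_gt0 xxs)) !mulf_eq0 pnatr_eq0 subr_eq0 [lam == x]eq_sym (negbTE xl) /=.
by move/eqP.
Qed.

Lemma gauss_eq p : ((size p).+1 <= size xs + k)%N ->
  (forall x, x \in xs -> x != lam -> p.[x] = 0) ->
  L (2 * 'X * p) = 2 * lam * L p.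
Proof.
move=> sp p0; apply/eqP; rewrite eq_sym -subr_eq0 quadB // big_seq big1 // => x xxs.
have [->|xl] := eqVneq x lam; first by rewrite subrr mulr0 mul0r mulr0.
by rewrite p0 // !mulr0.
Qed.

Hypothesis inner_nodes :
  (k <= (size [seq x <- xs | (-1 < x < lam)%R]).+1)%N.

(** Two extremizers vanish at the other nodes, and to second order at the
    inner ones; since their difference has mass zero, it vanishes at lam too,
    so it has more zeros than its degree allows. *)
Lemma gauss_extremal_uniq p q :
  ((size p).+1 <= size xs + k)%N -> ((size q).+1 <= size xs + k)%N ->
  (forall x, -1 <= x <= 1 -> 0 <= p.[x]) ->
  (forall x, -1 <= x <= 1 -> 0 <= q.[x]) ->
  L (2 * 'X * p) = 2 * lam * L p -> L (2 * 'X * q) = 2 * lam * L q ->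
  L p = L q -> p = q.
Proof.
move=> sp sq p_ge0 q_ge0 ep eq Lpq; apply/eqP; rewrite -subr_eq0; apply/eqP.
set d := p - q.
have sd : ((size d).+1 <= size xs + k)%N.
  by rewrite (leq_ltn_trans (size_polyD _ _)) // size_polyN gtn_max sp.
have d0' x : x \in xs -> x != lam -> d.[x] = 0.
  by move=> xxs xl; rewrite hornerD hornerN !gauss_eq0 // subrr.
have d0 x : x \in xs -> d.[x] = 0.
  move=> xxs; have [->{x xxs}|xl] := eqVneq x lam; last exact: d0'.
  have : L d = 0 by rewrite linearB Lpq subrr.
  rewrite gauss_quadrature; last by lia.
  rewrite (bigD1_seq lam) //= big_seq_cond big1 ?addr0.
    move/eqP; rewrite mulf_eq0 gt_eqF ?weight_gt0 //= => /eqP //.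
  by move=> x /andP[xxs xl]; rewrite d0' // mulr0.
have [|g dE _] := omega_factor d0; first by lia.
have [g00|g0] := eqVneq g 0; first by rewrite dE g00 mulr0.
have sg : (size g < k)%N.
  move: sd; rewrite dE mulrC size_Mmonic ?monic_prod_XsubC //.
  by rewrite size_prod_XsubC => sd'; lia.
have : all (root g) [seq x <- xs | -1 < x < lam].
  apply/allP => x; rewrite mem_filter => /andP[/andP[x1 xl] xxs].
  have xN : x != lam by rewrite lt_eqF.
  have l1 : lam <= 1 by have /andP[] := xs_itv lam_xs.
  have dp (r : {poly R}) : (forall x, -1 <= x <= 1 -> 0 <= r.[x]) ->
      r.[x] = 0 -> r^`().[x] = 0.
    move=> r_ge0 /rootP r0; apply: (@deriv_eq0_of_ge0 _ r (-1) lam x) => //.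
      by rewrite x1.
    by move=> z /andP[z1 zl]; rewrite r_ge0 // (ltW z1) (ltW (lt_le_trans zl l1)).
  have : d^`().[x] = 0.
    by rewrite derivB hornerD hornerN !dp ?subrr ?gauss_eq0.
  have omE : omega = lag x * ('X - x%:P).
    by rewrite mulrC /omega (perm_big _ (perm_to_rem xxs)) big_cons.
  rewrite dE omE derivM derivM derivXsubC !hornerE subrr !mulr0 add0r.
  rewrite mul0r addr0 => /eqP; rewrite mulf_eq0 (negbTE (lag_neq0 xxs)).
  by [].
move/(max_poly_roots g0) => /(_ (filter_uniq _ xs_uniq)) h.
by have := leq_trans inner_nodes h; rewrite leqNgt sg.
Qed.

End GaussQuadrature.

Import ComplexField.Normc.

(** * Typically real polynomials and their boundary values *)

Section TypicallyReal.
Variable R : realType.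
Implicit Types (P : {poly R}) (x y t r : R) (z w : R[i]).

Local Notation S := (chebS R).
Local Notation Im := (@complex.Im R).
Local Notation Re := (@complex.Re R).

(** $\Im P(e^{it}) = p(\cos t)\sin t$ for the profile p of P. *)
Definition profile P : {poly R} := \sum_(j < size P) P`_j *: S j.

Lemma profile_wide P n : (size P <= n)%N -> profile P = \sum_(j < n) P`_j *: S j.
Proof.
move=> Pn; rewrite /profile (big_ord_widen n (fun j => P`_j *: S j)) //.
rewrite [RHS](bigID (fun j : 'I_n => (j < size P)%N)) /=.
rewrite [X in _ = _ + X]big1 ?addr0 // => j.
by rewrite -leqNgt => jP; rewrite nth_default ?scale0r.
Qed.

Lemma size_profile P n : (size P <= n.+1)%N -> (size (profile P) <= n)%N.
Proof.
move=> Pn; rewrite (profile_wide Pn) (leq_trans (size_sum _ _ _)) //.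
apply/bigmax_leqP => -[j jn] _ /=; rewrite (leq_trans (size_scale_leq _ _)) //.
by case: j jn => [|j] jn; rewrite ?size_poly0 // (size_chebS _ _).1.
Qed.

(** The coefficients of P are the sine coefficients of its boundary values. *)
Lemma sinquad_chebSM_profile P M j : (0 < j)%N -> (j + size P <= 2 * M)%N ->
  sinquad M (S j * profile P) = P`_j.
Proof.
move=> j0 jM; rewrite /profile mulr_sumr linear_sum /=.
have E (i : 'I_(size P)) : true ->
    sinquad M (S j * (P`_i *: S i)) = P`_i * (i == j :> nat)%:R.
  move=> _; rewrite -scalerAr linearZ /=; case: i => -[|i] iP /=.
    by rewrite chebS0 mulr0 linear0 mulr0 eq_sym (gtn_eqF j0) mulr0.
  by rewrite sinquad_chebSM // 1?eq_sym //; lia.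
rewrite (eq_bigr _ E); have [jP|Pj] := ltnP j (size P).
  rewrite (bigD1 (Ordinal jP)) //= eqxx mulr1 big1 ?addr0 // => i.
  by rewrite -val_eqE /= => /negbTE ->; rewrite mulr0.
rewrite nth_default // big1 // => -[i iP] _ /=.
by rewrite ltn_eqF ?mulr0 // (leq_trans iP).
Qed.

Lemma Im_add z w : Im (z + w) = Im z + Im w.
Proof. by case: z => ? ?; case: w. Qed.

Lemma Im_realM x z : Im (real_complex R x * z) = x * Im z.
Proof. by case: z => a b /=; rewrite mul0r addr0. Qed.

Lemma Im_sum n (F : nat -> R[i]) :
  Im (\sum_(j < n) F j) = \sum_(j < n) Im (F j).
Proof. by elim: n => [|n IH]; rewrite ?big_ord0 // !big_ord_recr Im_add IH. Qed.

Lemma chornerE P z :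
  chorner P z = \sum_(j < size P) real_complex R P`_j * z ^+ j.
Proof.
rewrite /chorner horner_coef size_map_poly.
by apply: eq_bigr => j _; rewrite coef_map.
Qed.

Lemma Im_chorner P z : Im (chorner P z) = \sum_(j < size P) P`_j * Im (z ^+ j).
Proof.
rewrite chornerE (Im_sum _ (fun j => real_complex R P`_j * z ^+ j)).
by apply: eq_bigr => j _; exact: Im_realM.
Qed.

Lemma chorner_real P x : chorner P (real_complex R x) = real_complex R P.[x].
Proof. by rewrite /chorner horner_map. Qed.

Lemma chorner_conj P z : chorner P (conjc z) = conjc (chorner P z).
Proof.
rewrite !chornerE rmorph_sum; apply: eq_bigr => j _.
by rewrite rmorphM rmorphXn /= oppr0.
Qed.

Lemma derivable_horner_num (K : numFieldType) (q : {poly K}) (a : K) :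
  derivable (horner q : K^o -> K^o) a 1.
Proof.
elim/poly_ind: q => [|q c IH].
  have -> : horner (0 : {poly K}) = cst 0.
    by apply/funext => w; rewrite horner0.
  exact: derivable_cst.
have -> : horner (q * 'X + c%:P) =
    ((horner q : K^o -> K^o) * (@id K^o) + cst (c : K^o))%R.
  by apply/funext => w; rewrite !hornerE.
apply: derivableD; last exact: derivable_cst.
by apply: derivableM; [exact: IH | exact: derivable_id].
Qed.

Lemma chorner_holomorphic P : holomorphic_on_disk (chorner P).
Proof. by move=> z _; exact: (@derivable_horner_num R[i]). Qed.

Lemma deMoivre r t n :
  ((r * cos t) +i* (r * sin t))%C ^+ n =
  ((r ^+ n * cos (n%:R * t)) +i* (r ^+ n * sin (n%:R * t)))%C.
Proof.
elim: n => [|n IH]; first by rewrite !expr0 mul0r cos0 sin0 mulr1 mulr0.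
rewrite exprS IH -[n.+1]addn1 natrD mulrDl mul1r cosD sinD exprD expr1.
by apply/eqP; rewrite eq_complex /=; apply/andP; split; apply/eqP; ring.
Qed.

(** Radial limits of the positive imaginary part. *)
Lemma profile_ge0 P x : typically_real (chorner P) ->
  -1 <= x <= 1 -> 0 <= (profile P).[x].
Proof.
move=> [_ _ tr].
have inner y : -1 < y < 1 -> 0 <= (profile P).[y].
  move=> /andP[y1 y2]; pose t := acos y.
  have ty : cos t = y by rewrite acosK // in_itv /= !ltW.
  have t0 : 0 < t by rewrite acos_gt0 // y2 ltW.
  have tpi : t < pi by rewrite acos_ltpi // y1 ltW.
  have st : 0 < sin t by rewrite sin_gt0_pi // t0.
  pose q : {poly R} := \poly_(j < size P) (P`_j * sin (j%:R * t)).
  have qE r : q.[r] = Im (chorner P ((r * cos t) +i* (r * sin t))%C).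
    rewrite Im_chorner horner_poly; apply: eq_bigr => j _.
    by rewrite deMoivre /=; ring.
  have : 0 <= q.[1].
    apply: (@horner_ge0_right _ q 0 1 ltr01) => r /andP[r0 r1].
    have rs : 0 < r * sin t by rewrite mulr_gt0.
    rewrite qE; have := tr ((r * cos t) +i* (r * sin t))%C.
    rewrite complex_real gt_eqF //= normc_def /=.
    have -> : (r * cos t) ^+ 2 + (r * sin t) ^+ 2 = r ^+ 2.
      by rewrite !exprMn -mulrDr cos2Dsin2 mulr1.
    rewrite sqrtr_sqr gtr0_norm // -[1]/(real_complex R 1) ltcR r1.
    by move=> /(_ isT isT); rewrite pmulr_lgt0 // => /ltW.
  rewrite horner_poly => q1; rewrite -(pmulr_lge0 _ st) /profile horner_sum.
  rewrite mulr_suml; apply: le_trans q1 _; rewrite le_eqVlt; apply/orP; left.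
  apply/eqP/eq_bigr => j _.
  by rewrite expr1n mulr1 hornerZ -mulrA -ty chebS_trig.
move=> /andP[]; rewrite (le_eqVlt (-1)) (le_eqVlt x) => /orP[/eqP<-|x1] /orP[/eqP x2|x2].
- by move: x2; lra.
- by apply: (@horner_ge0_left _ _ (-1) 1) => //; lra.
- by rewrite x2; apply: (@horner_ge0_right _ _ (-1) 1) => //; lra.
- by apply: inner; rewrite x1.
Qed.

(** ** Positivity of the discretized kernel *)

(** The generating function of the Chebyshev polynomials, truncated. *)
Lemma sum_chebS_expr x z M :
  (\sum_(j < M.+1) real_complex R (S j).[x] * z ^+ j) *
    (1 - 2 * real_complex R x * z + z ^+ 2) =
  z - real_complex R (S M.+1).[x] * z ^+ M.+1
    + real_complex R (S M).[x] * z ^+ M.+2.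
Proof.
elim: M => [|M IH].
  rewrite big_ord_recl big_ord0 chebS0 chebS1 horner0 hornerC.
  by rewrite rmorph0 rmorph1 expr1; ring.
rewrite big_ord_recr /= mulrDl IH horner_chebS_rec rmorphB !rmorphM /= rmorph_nat.
by rewrite !exprS; ring.
Qed.

Lemma normc_gt0_Im z : 0 < Im z -> 0 < normc z.
Proof.
case: z => a b /= b0; rewrite sqrtr_gt0.
by rewrite ltr_wpDl ?sqr_ge0 // exprn_gt0.
Qed.

Lemma Im_ge_normc z : - normc z <= Im z.
Proof.
case: z => a b /=; rewrite lerNl (le_trans (ler_norm _)) // normrN -sqrtr_sqr.
by rewrite ler_wsqrtr // lerDr sqr_ge0.
Qed.

Lemma sqr_normc_def z : normc z ^+ 2 = Re z ^+ 2 + Im z ^+ 2.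
Proof. by case: z => a b /=; rewrite sqr_sqrtr // addr_ge0 ?sqr_ge0. Qed.

Lemma normcX z n : normc (z ^+ n) = normc z ^+ n.
Proof. by elim: n => [|n IH]; rewrite ?normc1 // !exprS normcM IH. Qed.

Lemma normc_real x : normc (real_complex R x) = `|x|.
Proof. by rewrite /= expr0n addr0 sqrtr_sqr. Qed.

(** At a node of the sine transform the partial sum of $\sum_j S_j(x)z^j$ is
    $(z \pm z^{M+1})/(1-2xz+z^2)$, and $z/(1-2xz+z^2)$ is typically real. *)
Lemma kernel_gt0 M k z : (0 < k < M)%N -> 0 < Im z ->
  4 * normc z ^+ M.+1 < Im z * (1 - normc z ^+ 2) ->
  0 < \sum_(j < M) (S j).[cos (node R M k)] * Im (z ^+ j).
Proof.
move=> kM z0 zM; set x := cos _.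
have /andP[x1 x2] : -1 < x < 1 by exact: cos_node_itv.
pose w := 1 - 2 * real_complex R x * z + z ^+ 2.
pose e : R := - (-1) ^+ k.
pose T := \sum_(j < M) real_complex R (S j).[x] * z ^+ j.
have -> : \sum_(j < M) (S j).[x] * Im (z ^+ j) = Im T.
  rewrite (Im_sum _ (fun j => real_complex R (S j).[x] * z ^+ j)).
  by apply: eq_bigr => j _; rewrite Im_realM.
have Tw : T * w = z + real_complex R e * z ^+ M.+1.
  have eM : M.-1.+1 = M by lia.
  have := sum_chebS_expr x z M.-1; rewrite eM -/T -/w => ->.
  rewrite /x chebS_node // rmorph0 mul0r subr0 /e.
  have := horner_chebS_rec M.-1 (cos (node R M k)).
  by rewrite eM chebS_node_succ // chebS_node // mulr0 sub0r => ->; rewrite opprK.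
have rho1 : normc z < 1.
  rewrite ltNge; apply/negP => rho1; move: zM; rewrite ltNge => /negP; apply.
  rewrite (le_trans (y := 0)) //; last by rewrite mulr_ge0 // exprn_ge0 // (le_trans ler01).
  by rewrite pmulr_rle0 // subr_le0 exprn_ege1.
have rho0 := normc_gt0_Im z0.
have nw : normc w <= 4.
  rewrite (le_trans (le_normcD _ _)) // normcX.
  have : normc (1 - 2 * real_complex R x * z) <= 3.
    rewrite (le_trans (le_normcD _ _)) // normc1 normcN !normcM normc_real.
    rewrite -[2]/(1 + 1) (_ : 1 + 1 = real_complex R 2) ?normc_real; last first.
      by rewrite rmorph_nat.
    rewrite ger0_norm //.
    have : `|x| <= 1 by rewrite ler_norml !ltW.
    have : 0 <= `|x| by [].
    nra.
  have : normc z ^+ 2 <= 1 by rewrite expr_le1 // ltW.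
  by move=> ? ?; lra.
have key : 0 < Im (T * w * conjc w).
  rewrite Tw mulrDl Im_add.
  have -> : Im (z * conjc w) = Im z * (1 - normc z ^+ 2).
    rewrite sqr_normc_def /w; case: (z) => a b; rewrite /= !expr2 /=; ring.
  have : - (4 * normc z ^+ M.+1) <= Im (real_complex R e * z ^+ M.+1 * conjc w).
    rewrite (le_trans _ (Im_ge_normc _)) // lerN2 !normcM normc_real normcX.
    have -> : `|e| = 1 by rewrite normrN normrX normrN1 expr1n.
    rewrite mul1r mulrC ler_pM2r ?exprn_gt0 //.
    by move: nw; rewrite /normc; case: (w) => a b /=; rewrite sqrrN.
  by move: zM => ? ?; lra.
have : Im (T * w * conjc w) = Im T * normc w ^+ 2.
  by rewrite sqr_normc_def; case: (T) => a b; case: (w) => c d /=; ring.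
move=> kE; move: key; rewrite kE => key; rewrite ltNge; apply/negP => T0.
by have := mulr_le0_ge0 T0 (sqr_ge0 (normc w)); rewrite leNgt key.
Qed.

Lemma expr_small r e n : 0 <= r < 1 -> 0 < e -> exists2 M, (n <= M)%N & r ^+ M < e.
Proof.
move=> /andP[r0 r1] e0; have rn : `|r| < 1 by rewrite ger0_norm.
have /cvgrPdist_lt/(_ e e0) [K _ KP] := cvg_expr rn.
exists (maxn K n); first exact: leq_maxr.
have := KP (maxn K n) (leq_maxl _ _).
by rewrite sub0r normrN ger0_norm // exprn_ge0.
Qed.

(** Poisson's formula in discrete form: by [sinquad_chebSM_profile], $\Im P(z)$
    is an average of the boundary values of P against the kernel of
    [kernel_gt0]. *)
Lemma Im_chorner_gt0 P z : P`_1 = 1 ->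
  (forall x, -1 <= x <= 1 -> 0 <= (profile P).[x]) ->
  normc z < 1 -> 0 < Im z -> 0 < Im (chorner P z).
Proof.
move=> P1 P_ge0 z1 z0; have rho0 := normc_gt0_Im z0.
have [||M PM zM] := @expr_small (normc z) (Im z * (1 - normc z ^+ 2) / 4)
  (size P).+2.
- by rewrite ltW.
- by rewrite divr_gt0 // mulr_gt0 // subr_gt0 expr_lt1 // ltW.
pose p k := (profile P).[cos (node R M k)] * sin (node R M k) ^+ 2.
pose T k := \sum_(j < M) (S j).[cos (node R M k)] * Im (z ^+ j).
have p_ge0 (k : 'I_M) : 0 <= p k.
  case: k => -[|k] kM; rewrite /p /=; first by rewrite /node !mul0r sin0 expr0n mulr0.
  rewrite mulr_ge0 ?sqr_ge0 // P_ge0 //.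
  have /andP[? ?] : -1 < cos (node R M k.+1) < 1 by apply: cos_node_itv.
  by rewrite !ltW.
have pT (k : 'I_M) : 0 <= p k * T k.
  case: k (p_ge0 k) => -[|k] kM pk; rewrite /=.
    by rewrite /p /node !mul0r sin0 expr0n mulr0 mul0r.
  rewrite mulr_ge0 // ltW // kernel_gt0 //.
  rewrite exprSr; move: zM; rewrite ltr_pdivlMr // => zM.
  apply: le_lt_trans zM; rewrite mulrA [4 * _]mulrC.
  by rewrite ler_piMr ?mulr_ge0 ?exprn_ge0 // ltW.
have pos (k : 'I_M) : 0 < p k -> 0 < T k.
  case: k => -[|k] kM /=; first by rewrite /p /node !mul0r sin0 expr0n mulr0 ltxx.
  move=> _; rewrite kernel_gt0 //.
  rewrite exprSr; move: zM; rewrite ltr_pdivlMr // => zM.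
  apply: le_lt_trans zM; rewrite mulrA [4 * _]mulrC.
  by rewrite ler_piMr ?mulr_ge0 ?exprn_ge0 // ltW.
have mass : 2 / M%:R * \sum_(k < M) p k = 1.
  rewrite -[RHS]P1 -(@sinquad_chebSM_profile P M 1) //; last by lia.
  by rewrite chebS1 mul1r.
have M0 : 0 < 2 / M%:R :> R by rewrite divr_gt0 // ltr0n; lia.
have -> : Im (chorner P z) = 2 / M%:R * \sum_(k < M) p k * T k.
  rewrite Im_chorner (big_ord_widen M (fun j => P`_j * Im (z ^+ j))); last by lia.
  rewrite [LHS](_ : _ = \sum_(j < M) P`_j * Im (z ^+ j)); last first.
    rewrite [RHS](bigID (fun j : 'I_M => (j < size P)%N)) /=.
    rewrite [X in _ = _ + X]big1 ?addr0 // => j; rewrite -leqNgt => jP.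
    by rewrite nth_default ?mul0r.
  under [in RHS]eq_bigr => k _ do rewrite /T mulr_sumr.
  rewrite exchange_big /= mulr_sumr; apply: eq_bigr => -[[|j] jM] _ /=.
    rewrite ?expr0 /= ?mulr0 big1 ?mulr0 // => k _.
    by rewrite chebS0 horner0 mul0r mulr0.
  rewrite -(@sinquad_chebSM_profile P M j.+1) //; last by lia.
  rewrite /sinquad -!mulrA; congr (_ * (_ * _)).
  rewrite mulr_suml; apply: eq_bigr => k _.
  by rewrite hornerM /p; ring.
rewrite mulr_gt0 // lt0r sumr_ge0 ?andbT // psumr_eq0 //.
apply/negP => /allP all0; move: mass; rewrite big1 ?mulr0.
  by move/eqP; rewrite eq_sym oner_eq0.
move=> k _; apply/eqP; rewrite eq_le p_ge0 andbT leNgt; apply/negP => pk.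
have := all0 k (mem_index_enum _).
by rewrite /= mulf_eq0 !gt_eqF ?pos.
Qed.

Lemma normc_lt1 z : (`|z| < 1) = (normc z < 1).
Proof. by rewrite -[1]/(real_complex R 1) -ltcR. Qed.

Lemma typically_real_of_profile P : P`_1 = 1 ->
  (forall x, -1 <= x <= 1 -> 0 <= (profile P).[x]) -> typically_real (chorner P).
Proof.
move=> P1 P_ge0; split; first exact: chorner_holomorphic.
  by move=> z _ /complex_realP[x ->]; rewrite chorner_real complex_real.
move=> z; rewrite normc_lt1 => z1; have [b0|b0|b0] := ltrgtP (Im z) 0.
- move=> _; rewrite nmulr_lgt0 // -oppr_gt0.
  have -> : - Im (chorner P z) = Im (chorner P (conjc z)).
    by rewrite chorner_conj; case: (chorner P z).
  apply: Im_chorner_gt0 => //; last by case: z b0 {z1} => a b /=; rewrite oppr_gt0.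
  by case: z z1 {b0} => a b /=; rewrite sqrrN.
- by move=> _; rewrite mulr_gt0 // Im_chorner_gt0.
- by case: z b0 {z1} => a b /= ->; rewrite complex_real eqxx.
Qed.

Lemma typically_real_polyP N P : (0 < N)%N ->
  typically_real_poly N P <->
  [/\ (size P <= N.+1)%N, P`_0 = 0, P`_1 = 1 &
      forall x, -1 <= x <= 1 -> 0 <= (profile P).[x]].
Proof.
move=> N0; split.
  move=> [[a PE] tr]; split; last by move=> x; exact: profile_ge0.
  - rewrite PE (leq_trans (size_polyD _ _)) // geq_max size_polyX ltnS N0 /=.
    rewrite (leq_trans (size_sum _ _ _)) // big_seq_cond.
    apply/bigmax_leqP_seq => j; rewrite mem_index_iota => /andP[_ jN] _.
    by rewrite (leq_trans (size_scale_leq _ _)) // size_polyXn; lia.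
  - rewrite PE coefD coefX coef_sum add0r big_seq big1 // => j.
    by rewrite mem_index_iota coefZ coefXn => /andP[]; case: j => // j; rewrite mulr0.
  - rewrite PE coefD coefX coef_sum big_seq big1 ?addr0 // => j.
    by rewrite mem_index_iota coefZ coefXn => /andP[]; case: j => [|[]] // j; rewrite mulr0.
move=> [sP P0 P1 P_ge0]; split; last exact: typically_real_of_profile.
exists (fun j => P`_j); apply/polyP => i.
rewrite coefD coefX coef_sum.
under eq_bigr => j _ do rewrite coefZ coefXn.
have [iN|Ni] := ltnP i N.+1; last first.
  rewrite nth_default ?(leq_trans sP) // big_seq big1 ?addr0.
    by rewrite gtn_eqF // (leq_trans _ Ni).
  by move=> j; rewrite mem_index_iota => jN; rewrite gtn_eqF ?mulr0 //; lia.
case: i iN => [|[|i]] iN /=.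
- rewrite P0 add0r big_seq big1 // => j; rewrite mem_index_iota.
  by case: j => // j _; rewrite mulr0.
- rewrite P1 big_seq big1 ?addr0 // => j; rewrite mem_index_iota.
  by case: j => [|[|j]] // _; rewrite mulr0.
rewrite add0r (bigD1_seq i.+2) ?iota_uniq ?mem_index_iota //=.
rewrite eqxx mulr1 big1 ?addr0 // => j /negbTE ji.
by rewrite eq_sym ji mulr0.
Qed.

End TypicallyReal.

(** * Extremal typically real polynomials *)

Section Extremal.
Variable R : realType.
Implicit Types (P Q p q g : {poly R}) (x y : R).

Local Notation S := (chebS R).

(** For a monomial g, the recurrence lowers the degree of g by one and moves
    the index j by one, so that it never reaches 1. *)
Lemma sinquad_chebS_orth M j g : (size g < j)%N -> (j + size g < 2 * M)%N ->
  sinquad M (S j * g) = 0.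
Proof.
move=> gj jM.
have mon i : (i.+1 < j)%N -> (j + i.+1 < 2 * M)%N -> sinquad M (S j * 'X^i) = 0.
  elim: i j {gj jM} => [|i IH] [|j] // ij jM.
    by rewrite expr0 mulr1 sinquad_chebS ?gtn_eqF //; lia.
  have -> : S j.+1 * 'X^(i.+1) = 2^-1 *: (S j.+2 * 'X^i + S j * 'X^i).
    rewrite chebS_rec exprS -mul_polyC.
    have -> : (2 * 'X * S j.+1 - S j) * 'X^i + S j * 'X^i =
      (2 : R)%:P * (S j.+1 * ('X * 'X^i)) by rewrite -two_polyC; ring.
    by rewrite [RHS]mulrA -polyCM mulVf ?pnatr_eq0 // mul1r.
  by rewrite linearZ linearD /= !IH ?addr0 ?mulr0 //; lia.
rewrite -[g]coefK poly_def mulr_sumr linear_sum big1 // => -[i ig] _ /=.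
by rewrite -scalerAr linearZ /= mon ?mulr0 //; lia.
Qed.

Lemma profile_inj P Q : P`_0 = Q`_0 -> profile P = profile Q -> P = Q.
Proof.
move=> e0 e; apply/polyP => -[//|j].
pose M := (j.+1 + size P + size Q)%N.
rewrite -(@sinquad_chebSM_profile _ P M) //; last by lia.
by rewrite e sinquad_chebSM_profile //; lia.
Qed.

(** The hypotheses cover both parities: the degree N - 1 of the profile leaves
    room for one more factor in a quadrature with [size xs] nodes, orthogonal up
    to size k, and all but at most one of the nodes other than lam are inner. *)
Section Nodes.
Variables (N k : nat) (xs : seq R) (W : {poly R}) (lam : R).
Hypothesis N_gt0 : (0 < N)%N.
Hypothesis xs_uniq : uniq xs.
Hypothesis size_xs_k : (size xs <= k.+1)%N.
Hypothesis size_xs_N : (size xs <= N.+1)%N.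
Hypothesis exactness : (N.+1 <= size xs + k)%N.
Hypothesis W_size : size W = (size xs).+1.
Hypothesis W_roots : all (root W) xs.
Hypothesis W_orth : forall M g, (N < M)%N -> (size g <= k)%N ->
  (size xs + k < 2 * M)%N -> sinquad M (W * g) = 0.
Hypothesis lam_xs : lam \in xs.
Hypothesis xs_itv : forall x, x \in xs -> -1 <= x <= 1.
Hypothesis xs_max : forall x, x \in xs -> x <= lam.
Hypothesis inner_nodes : (k <= (size [seq x <- xs | (-1 < x < lam)%R]).+1)%N.

Let M := (2 * N + k).+3.

Let L_sqr_gt0 p : p != 0 -> (size p <= size xs)%N -> 0 < sinquad M (p ^+ 2).
Proof.
move=> p0 pxs; apply: sinquad_gt0; first by rewrite expf_neq0.
  by rewrite (leq_ltn_trans (size_poly_exp_leq _ _)) // /M; lia.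
by move=> x _; rewrite horner_exp sqr_ge0.
Qed.

Let L_orth g : (size g <= k)%N ->
  sinquad M (\prod_(x <- xs) ('X - x%:P) * g) = 0.
Proof.
move=> gk; have lW : lead_coef W != 0.
  by rewrite lead_coef_eq0 -size_poly_eq0 W_size.
apply: (mulfI lW); rewrite mulr0 -[LHS]linearZ /= scalerAl.
rewrite -all_roots_prod_XsubC ?uniq_rootsE //.
by apply: W_orth; rewrite // /M; lia.
Qed.

Let profileP P : typically_real_poly N P ->
  [/\ ((size (profile P)).+1 <= size xs + k)%N,
      forall x, -1 <= x <= 1 -> 0 <= (profile P).[x],
      sinquad M (profile P) = 1
    & sinquad M (2 * 'X * profile P) = P`_2].
Proof.
move=> /(typically_real_polyP _ N_gt0) [sP P0 P1 P_ge0]; split=> //.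
- by rewrite (leq_trans _ exactness) // ltnS size_profile.
- rewrite -[profile P]mul1r -chebS1 sinquad_chebSM_profile //.
  by rewrite /M; lia.
- have -> : 2 * 'X = S 2 by rewrite chebS_rec chebS0 chebS1 subr0 mulr1.
  by rewrite sinquad_chebSM_profile // /M; lia.
Qed.

Lemma second_coef_le P : typically_real_poly N P -> P`_2 <= 2 * lam.
Proof.
move=> /profileP[sp p_ge0 p1 <-].
have := gauss_le xs_uniq size_xs_k L_sqr_gt0 L_orth lam_xs xs_itv xs_max sp p_ge0.
by rewrite /= p1 mulr1.
Qed.

Lemma second_coef_eq P : typically_real_poly N P ->
  (forall x, x \in xs -> x != lam -> (profile P).[x] = 0) -> P`_2 = 2 * lam.
Proof.
move=> /profileP[sp p_ge0 p1 <-] p0.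
have := gauss_eq xs_uniq size_xs_k L_orth lam_xs sp p0.
by rewrite /= p1 mulr1.
Qed.

Lemma upper_extremizer_uniq P Q :
  upper_extremizer N (2 * lam) P -> upper_extremizer N (2 * lam) Q -> P = Q.
Proof.
move=> [trP P2] [trQ Q2].
have [sp p_ge0 p1 p2] := profileP trP; have [sq q_ge0 q1 q2] := profileP trQ.
apply: profile_inj.
  by case/(typically_real_polyP _ N_gt0): trP => _ -> _ _;
     case/(typically_real_polyP _ N_gt0): trQ => _ -> _ _.
apply: (gauss_extremal_uniq xs_uniq size_xs_k L_sqr_gt0 L_orth lam_xs
         xs_itv xs_max inner_nodes sp sq) => //.
- by rewrite /= p1 p2 P2 mulr1.
- by rewrite /= q1 q2 Q2 mulr1.
- by rewrite /= p1 q1.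
Qed.

End Nodes.

(** ** The symmetry $P(z) \mapsto -P(-z)$ *)

Lemma coef_negate_even_coefs P j :
  (negate_even_coefs P)`_j = if odd j then P`_j else - P`_j.
Proof.
rewrite coef_poly; case: ltnP => // Pj; rewrite nth_default // oppr0.
by case: odd.
Qed.

Lemma negate_even_coefsK P : negate_even_coefs (negate_even_coefs P) = P.
Proof.
by apply/polyP => j; rewrite !coef_negate_even_coefs; case: odd; rewrite ?opprK.
Qed.

Lemma size_negate_even_coefs P : (size (negate_even_coefs P) <= size P)%N.
Proof. exact: size_poly. Qed.

Lemma profile_negate_even_coefs P x :
  (profile (negate_even_coefs P)).[x] = (profile P).[- x].
Proof.
rewrite (profile_wide (size_negate_even_coefs P)) /profile !horner_sum.
apply: eq_bigr => j _; rewrite !hornerZ coef_negate_even_coefs chebS_opp.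
by rewrite -signr_odd /=; case: odd; rewrite /= ?expr0 ?expr1; ring.
Qed.

Lemma typically_real_poly_negate N P : (0 < N)%N ->
  typically_real_poly N P -> typically_real_poly N (negate_even_coefs P).
Proof.
move=> N0 /(typically_real_polyP _ N0)[sP P0 P1 P_ge0].
apply/(typically_real_polyP _ N0); split.
- exact: leq_trans (size_negate_even_coefs P) sP.
- by rewrite coef_negate_even_coefs /= P0 oppr0.
- by rewrite coef_negate_even_coefs.
- move=> x /andP[x1 x2]; rewrite profile_negate_even_coefs P_ge0 //.
  by apply/andP; split; lra.
Qed.

Lemma second_coef_norm_le N B : (0 < N)%N ->
  (forall P, typically_real_poly N P -> P`_2 <= B) ->
  forall P, typically_real_poly N P -> `|P`_2| <= B.
Proof.
move=> N0 le_B P trP; rewrite ler_norml le_B // andbT lerNl.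
have := le_B _ (typically_real_poly_negate N0 trP).
by rewrite coef_negate_even_coefs.
Qed.

Lemma lower_extremizerP N B P : (0 < N)%N ->
  (forall Q, upper_extremizer N B Q <-> Q = P) ->
  forall Q, lower_extremizer N B Q <-> Q = negate_even_coefs P.
Proof.
move=> N0 upP Q; split=> [[trQ Q2]|->].
  rewrite -[LHS]negate_even_coefsK; congr negate_even_coefs; apply/upP; split.
    exact: typically_real_poly_negate.
  by rewrite coef_negate_even_coefs /= Q2 opprK.
have [trP P2] := (upP P).2 erefl; split; first exact: typically_real_poly_negate.
by rewrite coef_negate_even_coefs /= P2.
Qed.

End Extremal.

(** * Evaluation tools for the compact forms *)

Section CompactTools.
Variable R : realType.
Implicit Types (P p q : {poly R}) (x z : R) (w : R[i]).

Lemma chornerD p q w : chorner (p + q) w = chorner p w + chorner q w.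
Proof. by rewrite /chorner rmorphD hornerD. Qed.

Lemma chornerB p q w : chorner (p - q) w = chorner p w - chorner q w.
Proof. by rewrite /chorner rmorphB hornerD hornerN. Qed.

Lemma chornerM p q w : chorner (p * q) w = chorner p w * chorner q w.
Proof. by rewrite /chorner rmorphM hornerM. Qed.

Lemma chornerXe p n w : chorner (p ^+ n) w = chorner p w ^+ n.
Proof. by rewrite /chorner rmorphXn horner_exp. Qed.

Lemma chornerC (c : R) w : chorner c%:P w = real_complex R c.
Proof. by rewrite /chorner map_polyC hornerC. Qed.

Lemma chornerX w : chorner 'X w = w.
Proof. by rewrite /chorner map_polyX hornerX. Qed.

Lemma chorner1 w : chorner (1 : {poly R}) w = 1.
Proof. by rewrite /chorner rmorph1 hornerC. Qed.

Lemma chorner_nat n w : chorner (n%:R : {poly R}) w = n%:R.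
Proof. by rewrite /chorner rmorph_nat -polyC_natr hornerC. Qed.

Definition chorner_simp :=
  (chornerXe, chornerB, chornerD, chornerM, chornerC, chornerX, chorner1,
   chorner_nat).

(** Off the unit circle, $\Im P(e^{it}) = p(\cos t)\sin t$ becomes a relation
    between the values of P at z and 1/z. *)
Lemma profile_joukowski P z : z != 0 ->
  (profile P).[(z + z^-1) / 2] * (z - z^-1) = P.[z] - P.[z^-1].
Proof.
move=> z0; rewrite /profile horner_sum mulr_suml !horner_coef -sumrB.
by apply: eq_bigr => j _; rewrite hornerZ -mulrA chebS_joukowski // mulrBr.
Qed.

Lemma joukowski_gt1 x : 1 < x -> exists2 z, 1 < z & x = (z + z^-1) / 2.
Proof.
move=> x1; have x2 : 0 < x ^+ 2 - 1 by rewrite subr_gt0 expr_gt1 // ltW ?(lt_trans ltr01).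
have r2 := sqr_sqrtr (ltW x2); have r0 := sqrtr_ge0 (x ^+ 2 - 1).
set r := Num.sqrt _ in r2 r0; exists (x + r); first by lra.
have z0 : x + r != 0 by apply/lt0r_neq0; lra.
have -> : (x + r)^-1 = x - r.
  by apply: (mulfI z0); rewrite mulfV // -[1](subrK (x ^+ 2)) -opprB -r2; ring.
by field.
Qed.

Lemma poly_ext_joukowski p q :
  (forall z, 1 < z -> p.[(z + z^-1) / 2] = q.[(z + z^-1) / 2]) -> p = q.
Proof. by move=> e; apply: poly_ext_gt1 => x /joukowski_gt1[z z1 ->]; exact: e. Qed.

Lemma sum_pairs (V : zmodType) (F : nat -> V) n :
  \sum_(s < n.*2) F s = \sum_(j < n) (F j.*2 + F j.*2.+1).
Proof.
elim: n => [|n IH]; first by rewrite !big_ord0.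
by rewrite doubleS !big_ord_recr /= IH addrA.
Qed.

End CompactTools.

(** * Odd degree *)

Section OddDegree.
Variables (R : realType) (n : nat).
Hypothesis n_gt1 : (1 < n)%N.
Let N := n.*2.-1.

Local Notation S := (chebS R).
Local Notation m := (mu R N).
Let h : R := n.+1%:R.

Let node1 : (0 < 1 < n.+1)%N. Proof. by lia. Qed.
Let h_neq0 : h != 0. Proof. by rewrite pnatr_eq0. Qed.

Let n1_neq0 : 1 + n%:R != 0 :> R. Proof. by rewrite nat1r pnatr_eq0. Qed.
Let N3E : (N + 3 = n.+1 * 2)%N. Proof. by rewrite /N; lia. Qed.
Let NE : N%:R + 3 = 2 * h :> R.
Proof.
have : (N + 3 = 2 * n.+1)%N by rewrite /N; lia.
by move/(congr1 (fun k => k%:R : R)); rewrite natrD natrM.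
Qed.

Lemma theta_node : theta R N = node R n.+1 1.
Proof. by rewrite /theta /node NE mul1r -mulf_div divff ?pnatr_eq0 // mul1r. Qed.

Lemma mu_node : m = cos (node R n.+1 1).
Proof. by rewrite /mu theta_node. Qed.

Lemma mu_itv : -1 < m < 1.
Proof. by rewrite mu_node; apply: cos_node_itv; lia. Qed.

Lemma chebS_mu_succ : (S n.+1).[m] = 0.
Proof. by rewrite mu_node chebS_node. Qed.

Lemma chebS_mu : (S n).[m] = 1.
Proof.
have := horner_chebS_rec n m.
by rewrite chebS_mu_succ {1}mu_node chebS_node_succ // expr1 mulr0 sub0r => /oppr_inj.
Qed.

(** ** The bound *)

Definition sine_nodes : seq R := [seq cos (node R n.+1 k) | k <- iota 1 n].

Lemma sine_nodesP x :
  reflect (exists2 k, (0 < k < n.+1)%N & x = cos (node R n.+1 k)) (x \in sine_nodes).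
Proof.
apply: (iffP mapP) => -[k kn ->]; exists k => //.
  by move: kn; rewrite mem_iota add1n.
by rewrite mem_iota add1n.
Qed.

Lemma sine_nodes_uniq : uniq sine_nodes.
Proof.
rewrite map_inj_in_uniq ?iota_uniq // => i j; rewrite !mem_iota => iM jM.
by apply: cos_node_inj; lia.
Qed.

Lemma size_sine_nodes : size sine_nodes = n.
Proof. by rewrite size_map size_iota. Qed.

Lemma sine_nodes_itv x : x \in sine_nodes -> -1 <= x <= 1.
Proof.
move=> /sine_nodesP[k kn ->]; have /andP[? ?] := cos_node_itv R kn.
by rewrite !ltW.
Qed.

Lemma mu_sine_nodes : m \in sine_nodes.
Proof. by apply/sine_nodesP; exists 1%N; rewrite ?mu_node //; lia. Qed.

Lemma sine_nodes_max x : x \in sine_nodes -> x <= m.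
Proof.
move=> /sine_nodesP[k /andP[k0 kn] ->]; rewrite mu_node.
have [k1|/eqP k1] := ltnP 1 k; first by rewrite ltW // cos_node_lt // k1 ltnW.
by rewrite (_ : k = 1%N) //; lia.
Qed.

Lemma inner_sine_nodes :
  (n <= (size [seq x <- sine_nodes | (-1 < x < m)%R]).+1)%N.
Proof.
rewrite size_filter -[n in (n <= _)%N]prednK; last by lia.
rewrite ltnS /sine_nodes -[n in iota 1 n]prednK; last by lia.
rewrite /= count_map.
rewrite (leq_trans _ (leq_addl _ _)) // (@eq_in_count _ _ predT).
  by rewrite count_predT size_iota.
move=> k; rewrite mem_iota => /andP[k2 kn] /=.
have /andP[-> _] : -1 < cos (node R n.+1 k) < 1 by apply: cos_node_itv; lia.
by rewrite mu_node cos_node_lt //; lia.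
Qed.

Lemma sine_nodes_roots : all (root (S n.+1)) sine_nodes.
Proof. by apply/allP => _ /sine_nodesP[k kn ->]; apply/rootP; rewrite chebS_node. Qed.

Let N_gt0 : (0 < N)%N. Proof. by rewrite /N; lia. Qed.
Let xs_k : (size sine_nodes <= n.+1)%N. Proof. by rewrite size_sine_nodes. Qed.
Let xs_N : (size sine_nodes <= N.+1)%N. Proof. by rewrite size_sine_nodes /N; lia. Qed.
Let exact_N : (N.+1 <= size sine_nodes + n)%N.
Proof. by rewrite size_sine_nodes /N; lia. Qed.
Let W_size : size (S n.+1) = (size sine_nodes).+1.
Proof. by rewrite (size_chebS _ _).1 // size_sine_nodes. Qed.
Let W_orth M (g : {poly R}) : (N < M)%N -> (size g <= n)%N ->
  (size sine_nodes + n < 2 * M)%N -> sinquad M (S n.+1 * g) = 0.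
Proof.
by rewrite size_sine_nodes /N => NM gn nM; apply: sinquad_chebS_orth; lia.
Qed.

Lemma odd_second_coef_le (P : {poly R}) :
  typically_real_poly N P -> P`_2 <= 2 * m.
Proof.
exact: (second_coef_le N_gt0 sine_nodes_uniq xs_k xs_N exact_N W_size
  sine_nodes_roots W_orth mu_sine_nodes sine_nodes_itv sine_nodes_max
  inner_sine_nodes).
Qed.

Lemma odd_upper_extremizer_uniq (P Q : {poly R}) :
  upper_extremizer N (2 * m) P -> upper_extremizer N (2 * m) Q -> P = Q.
Proof.
exact: (upper_extremizer_uniq N_gt0 sine_nodes_uniq xs_k xs_N exact_N W_size
  sine_nodes_roots W_orth mu_sine_nodes sine_nodes_itv sine_nodes_max
  inner_sine_nodes).
Qed.

(** ** The extremal polynomial *)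

Definition odd_extremal_coef (s : nat) : R :=
  let j := s./2 in
  let u := (S j).[m] in let v := (S j.+1).[m] in
  if odd s then
    h^-1 * (m * u * v + (h - j%:R) * v ^+ 2 - (h - 1 - j%:R) * u ^+ 2)
  else 2 / h * u * ((h - j%:R) * v - m * (h - 1 - j%:R) * u).

Definition odd_extremal : {poly R} := \poly_(s < N.+1) odd_extremal_coef s.

Lemma odd_extremal_odd j : (0 < j)%N -> (j <= (N - 1) %/ 2)%N ->
  odd_extremal`_(2 * j + 1) = odd_coef_odd_index R N j.
Proof.
case: j => // j _ jN; have jN' : (2 * j.+1 + 1 < N.+1)%N by rewrite /N in jN *; lia.
rewrite coef_poly jN' /odd_extremal_coef addn1 mul2n /= odd_double /= uphalf_double.
have N3 : N%:R + 1 = 2 * h - 2 :> R by rewrite -NE; ring.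
by rewrite /odd_coef_odd_index NE N3; field.
Qed.

Lemma odd_extremal_even j : (0 < j)%N -> (j <= (N - 1) %/ 2)%N ->
  odd_extremal`_(2 * j) = odd_coef_even_index R N j.
Proof.
case: j => // j _ jN; have jN' : (2 * j.+1 < N.+1)%N by rewrite /N in jN *; lia.
rewrite coef_poly jN' /odd_extremal_coef mul2n odd_double doubleK.
have N3 : N%:R + 1 = 2 * h - 2 :> R by rewrite -NE; ring.
by rewrite /odd_coef_even_index NE N3; field.
Qed.

Lemma odd_extremal_0 : odd_extremal`_0 = 0.
Proof. by rewrite coef_poly /odd_extremal_coef /= chebS0 horner0 mulr0 mul0r. Qed.

Lemma odd_extremal_1 : odd_extremal`_1 = 1.
Proof.
rewrite coef_poly ltnS N_gt0 /odd_extremal_coef /= chebS0 chebS1 horner0 hornerC.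
by field.
Qed.

(** The tail $\sum_{s\ge 2j} a_s z^{s-2j}$ of the series obtained by letting the
    coefficient formulas run on for ever, times $h(1-z^2)(1-2mz+z^2)^2$, as a
    function of $u = S_j(m)$, $v = S_{j+1}(m)$ and $k = h-j$. *)
Let tail (z u v k : R) : R :=
  let b u v k := 2 * u * (k * v - m * (k - 1) * u) in
  let a u v k := m * u * v + k * v ^+ 2 - (k - 1) * u ^+ 2 in
  let w := 2 * m * v - u in let y := 2 * m * w - v in
  let c0 := b u v k in let c1 := a u v k in
  let c2 := b v w (k - 1) in let c3 := a v w (k - 1) in
  let c4 := b w y (k - 2) in let c5 := a w y (k - 2) in
  let q := 1 + 4 * m ^+ 2 in
  c0 + (c1 - 4 * m * c0) * z + (c2 - 4 * m * c1 + q * c0) * z ^+ 2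
  + (c3 - 4 * m * c2 + q * c1) * z ^+ 3
  + (c4 - 4 * m * c3 + q * c2 - q * c0) * z ^+ 4
  + (c5 - 4 * m * c4 + q * c3 - q * c1 + 4 * m * c0) * z ^+ 5.

(** The coefficients obey the linear recurrence attached to
    $(1-z^2)(1-2mz+z^2)^2$, so dropping two of them changes the tail only by
    their own contribution. *)
Let tail_step z u v k :
  tail z u v k = (1 - z ^+ 2) * (1 - 2 * m * z + z ^+ 2) ^+ 2 *
     (2 * u * (k * v - m * (k - 1) * u)
      + (m * u * v + k * v ^+ 2 - (k - 1) * u ^+ 2) * z)
    + z ^+ 2 * tail z v (2 * m * v - u) (k - 1).
Proof. rewrite /tail /=. ring. Qed.

Let odd_partial_sum z i :
  h * ((1 - z ^+ 2) * (1 - 2 * m * z + z ^+ 2) ^+ 2) *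
   (\sum_(j < i) (odd_extremal_coef j.*2 * z ^+ j.*2
                  + odd_extremal_coef j.*2.+1 * z ^+ j.*2.+1)) =
  tail z 0 1 h - z ^+ i.*2 * tail z (S i).[m] (S i.+1).[m] (h - i%:R).
Proof.
elim: i => [|i IH].
  by rewrite big_ord0 mulr0 chebS0 chebS1 horner0 hornerC subr0 mul1r subrr.
rewrite big_ord_recr /= mulrDr IH [tail _ (S i).[m] _ _]tail_step horner_chebS_rec.
have -> : h - i.+1%:R = h - i%:R - 1 by rewrite -[i.+1]addn1 natrD; ring.
rewrite /odd_extremal_coef /= odd_double uphalf_double doubleK.
by rewrite /= doubleS !exprS; field.
Qed.

Let d : {poly R} := 1 - 2 * 'X * m%:P + 'X ^+ 2.

(** By telescoping: the tail at j = 0 is the part of the right hand side free of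
    $z^{N+3}$, and the tail at j = n, where u = 1 and v = 0, is the rest. *)
Lemma odd_extremal_compact_poly :
  odd_extremal * ((1 - 'X ^+ 2) * d ^+ 2) =
  'X * ((1 - 'X ^+ 2) * d)
  + (2 / h * (1 - m ^+ 2))%:P * ('X ^+ 3 * (1 - 'X ^+ (N + 3))).
Proof.
apply: poly_ext_gt1 => z _; apply: (mulfI h_neq0).
have hd : d.[z] = 1 - 2 * m * z + z ^+ 2.
  by rewrite /d two_polyC !hornerE; ring.
rewrite hornerM [in LHS]hornerM horner_exp hd.
have -> : (1 - 'X ^+ 2 : {poly R}).[z] = 1 - z ^+ 2 by rewrite !hornerE.
rewrite {1}/odd_extremal horner_poly (_ : N.+1 = n.*2); last by rewrite /N; lia.
rewrite (@sum_pairs R (fun s => odd_extremal_coef s * z ^+ s)).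
rewrite [X in h * X]mulrC mulrA odd_partial_sum chebS_mu chebS_mu_succ.
have -> : h - n%:R = 1 by rewrite /h -[n.+1]addn1 natrD; ring.
have -> : (N + 3 = n.*2.+2)%N by rewrite /N; lia.
rewrite !(hd, horner_exp, hornerD, hornerN, hornerM, hornerX, hornerC) /tail.
by rewrite !exprS; field.
Qed.

Lemma odd_extremal_compact (z : R[i]) :
  1 - z ^+ 2 != 0 -> 1 - 2 * z * real_complex R m + z ^+ 2 != 0 ->
  chorner odd_extremal z = odd_compact N z.
Proof.
move=> z1 zd; have := congr1 (fun p => chorner p z) odd_extremal_compact_poly.
rewrite /d !chorner_simp rmorphM rmorphB rmorph1 rmorphXn => e.
have s2 : real_complex R (sin (theta R N)) ^+ 2 = 1 - real_complex R m ^+ 2.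
  by rewrite -rmorphXn /= sin2cos2 rmorphB rmorph1 rmorphXn.
have hc : N%:R + 3 = 2 * real_complex R h.
  by rewrite -(rmorph_nat (real_complex R) 2) -rmorphM -NE rmorphD !rmorph_nat.
rewrite /odd_compact s2 hc -/m.
set c := real_complex R m in zd e *.
have -> : chorner odd_extremal z =
  (z * ((1 - z ^+ 2) * (1 - 2 * z * c + z ^+ 2)) + real_complex R (2 / h)
     * (1 - c ^+ 2) * (z ^+ 3 * (1 - z ^+ (N + 3))))
   / ((1 - z ^+ 2) * (1 - 2 * z * c + z ^+ 2) ^+ 2).
  by rewrite -e mulfK // mulf_neq0 // expf_neq0.
rewrite fmorph_div rmorph_nat /=.
by field; rewrite zd z1 nat1r pnatr_eq0.
Qed.

(** Only the square of S remains after taking the imaginary part of the compact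
    form on the unit circle. *)
Lemma odd_profile_poly :
  profile odd_extremal * ('X - m%:P) ^+ 2 =
  ((1 - m ^+ 2) / (2 * h)) *: S n.+1 ^+ 2.
Proof.
apply: poly_ext_joukowski => z z1.
have z0 : z != 0 by rewrite gt_eqF // (lt_trans ltr01).
have zz : z - z^-1 != 0.
  rewrite subr_eq0 gt_eqF // (lt_trans _ z1) //.
  by rewrite invf_lt1 // (lt_trans ltr01).
have z2 : 1 - z ^+ 2 != 0.
  by rewrite subr_eq0 eq_sym gt_eqF // expr_gt1 // ltW ?(lt_trans ltr01).
have /andP[m1 m2] := mu_itv.
have zd : 1 - 2 * m * z + z ^+ 2 != 0 by apply/lt0r_neq0; nra.
have at_z y : odd_extremal.[y] * ((1 - y ^+ 2) * (1 - 2 * m * y + y ^+ 2) ^+ 2)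
  = y * ((1 - y ^+ 2) * (1 - 2 * m * y + y ^+ 2))
    + 2 / h * (1 - m ^+ 2) * (y ^+ 3 * (1 - y ^+ (N + 3))).
  have := congr1 (fun p => p.[y]) odd_extremal_compact_poly.
  rewrite /d !(horner_exp, hornerD, hornerN, hornerM, hornerX, hornerC, two_polyC).
  by rewrite [2 * y * m]mulrAC.
have P1 : odd_extremal.[z] = z / (1 - 2 * m * z + z ^+ 2) +
   2 / h * (1 - m ^+ 2) * (z ^+ 3 * (1 - z ^+ (N + 3))) /
   ((1 - z ^+ 2) * (1 - 2 * m * z + z ^+ 2) ^+ 2).
  apply: (mulIf (mulf_neq0 z2 (expf_neq0 2 zd))); rewrite at_z.
  by field; rewrite zd z2 n1_neq0.
have P2 : odd_extremal.[z^-1] = z / (1 - 2 * m * z + z ^+ 2) -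
   2 / h * (1 - m ^+ 2) * (z ^+ 3 * (1 - (z ^+ (N + 3))^-1)) /
   ((1 - z ^+ 2) * (1 - 2 * m * z + z ^+ 2) ^+ 2).
  have zd' : 1 - 2 * m * z^-1 + z^-1 ^+ 2 != 0.
    have -> : 1 - 2 * m * z^-1 + z^-1 ^+ 2 = (1 - 2 * m * z + z ^+ 2) / z ^+ 2 by field.
    by rewrite mulf_neq0 // invr_eq0 expf_neq0.
  have z2' : 1 - z^-1 ^+ 2 != 0.
    have -> : 1 - z^-1 ^+ 2 = - (1 - z ^+ 2) / z ^+ 2 by field.
    by rewrite mulf_neq0 ?oppr_eq0 // invr_eq0 expf_neq0.
  apply: (mulIf (mulf_neq0 z2' (expf_neq0 2 zd'))); rewrite at_z [z^-1 ^+ (N + 3)]exprVn.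
  by field; rewrite zd z2 n1_neq0 z0 expf_neq0.
apply: (mulIf zz); rewrite hornerM mulrAC profile_joukowski // P1 P2.
have Sz := chebS_joukowski n.+1 z0.
have SE : (S n.+1).[(z + z^-1) / 2] = (z ^+ n.+1 - (z ^+ n.+1)^-1) / (z - z^-1).
  by rewrite -exprVn -Sz mulfK.
have wN : z ^+ (N + 3) = (z ^+ n.+1) ^+ 2.
  by rewrite -exprM -N3E.
have XE : ('X - m%:P).[(z + z^-1) / 2] = (1 - 2 * m * z + z ^+ 2) / (2 * z).
  by rewrite hornerXsubC; field.
rewrite horner_exp hornerZ horner_exp SE XE wN.
have w0 : z ^+ n.+1 != 0 by rewrite expf_neq0.
set w := z ^+ n.+1 in w0 *.
by field; rewrite z0 w0 n1_neq0 zd z2 -expr2 -opprB oppr_eq0 z2.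
Qed.

(** The double zero at m cancels, which makes the profile a square. *)
Lemma odd_profile_sqr : exists2 A : {poly R}, S n.+1 = A * ('X - m%:P) &
  profile odd_extremal = ((1 - m ^+ 2) / (2 * h)) *: A ^+ 2.
Proof.
have [|A SA] := factor_theorem (S n.+1) m _; first by apply/rootP/chebS_mu_succ.
exists A => //; have X0 : ('X - m%:P) ^+ 2 != 0 :> {poly R}.
  by rewrite expf_neq0 // polyXsubC_eq0.
by apply: (mulIf X0); rewrite odd_profile_poly SA exprMn scalerAl.
Qed.

Lemma odd_extremal_typically_real : typically_real_poly N odd_extremal.
Proof.
apply/(typically_real_polyP _ N_gt0); split.
- exact: size_poly.
- exact: odd_extremal_0.
- exact: odd_extremal_1.
have [A _ ->] := odd_profile_sqr; have /andP[m1 m2] := mu_itv.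
move=> x _; rewrite hornerZ horner_exp mulr_ge0 ?sqr_ge0 // divr_ge0 //.
  by rewrite subr_ge0; nra.
by rewrite mulr_ge0 // ler0n.
Qed.

Lemma odd_upper_extremizerP (Q : {poly R}) :
  upper_extremizer N (2 * m) Q <-> Q = odd_extremal.
Proof.
have up : upper_extremizer N (2 * m) odd_extremal.
  split; first exact: odd_extremal_typically_real.
  apply: (second_coef_eq N_gt0 sine_nodes_uniq xs_k xs_N exact_N W_size
    sine_nodes_roots W_orth mu_sine_nodes
    inner_sine_nodes odd_extremal_typically_real) => x xxs xm.
  have [A SA ->] := odd_profile_sqr.
  have /allP/(_ x xxs)/rootP := sine_nodes_roots.
  rewrite SA hornerM hornerXsubC => /eqP; rewrite mulf_eq0 subr_eq0 (negbTE xm) orbF.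
  by move=> /eqP A0; rewrite hornerZ horner_exp A0 expr0n mulr0.
by split=> [upQ|->//]; exact: odd_upper_extremizer_uniq upQ up.
Qed.

End OddDegree.

(** * Even degree: the nodes and the bound *)

Section EvenNodes.
Variable R : realType.
Implicit Types (x y : R).

Local Notation S := (chebS R).

Lemma chebS_deriv j :
  (1 - 'X ^+ 2) * (S j)^`() = j.+1%:R * 'X * S j - j%:R * S j.+1.
Proof.
suff [] : (1 - 'X ^+ 2) * (S j)^`() = j.+1%:R * 'X * S j - j%:R * S j.+1 /\
  (1 - 'X ^+ 2) * (S j.+1)^`() = j.+2%:R * 'X * S j.+1 - j.+1%:R * S j.+2 by [].
elim: j => [|j [IH1 IH2]].
  rewrite chebS_rec chebS0 chebS1 deriv0 -[1 in X in _ /\ X]/(1%:P : {poly R}) derivC.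
  by split; ring.
split=> //.
have -> : (S j.+2)^`() = 2 * S j.+1 + 2 * 'X * (S j.+1)^`() - (S j)^`().
  rewrite chebS_rec two_polyC derivB -mulrA mul_polyC derivZ derivM derivX mul1r.
  by rewrite -!mul_polyC; ring.
have -> : (1 - 'X ^+ 2) * (2 * S j.+1 + 2 * 'X * (S j.+1)^`() - (S j)^`()) =
  2 * (1 - 'X ^+ 2) * S j.+1 + 2 * 'X * ((1 - 'X ^+ 2) * (S j.+1)^`())
  - (1 - 'X ^+ 2) * (S j)^`() by ring.
rewrite IH1 IH2 [S j.+3]chebS_rec chebS_rec -![_.+1%:R]natr1.
ring.
Qed.

(** The substitution $x = 1-2y^2$ turns the two equations of the bound into one
    another. *)
Lemma chebS_half_angle j y :
  (S j.+1).[1 - 2 * y ^+ 2] - (S j).[1 - 2 * y ^+ 2] = (-1) ^+ j * (S j.*2.+1).[y].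
Proof.
suff [] : (S j.+1).[1 - 2 * y ^+ 2] - (S j).[1 - 2 * y ^+ 2] =
    (-1) ^+ j * (S j.*2.+1).[y] /\
  (S j.+2).[1 - 2 * y ^+ 2] - (S j.+1).[1 - 2 * y ^+ 2] =
    (-1) ^+ j.+1 * (S j.+1.*2.+1).[y] by [].
elim: j => [|j [IH1 IH2]].
  rewrite !horner_chebS_rec /= !chebS0 !chebS1 !horner0 !hornerC expr0 expr1.
  by split; ring.
split=> //; rewrite doubleS in IH2.
rewrite !doubleS.
have -> : (S j.+3).[1 - 2 * y ^+ 2] - (S j.+2).[1 - 2 * y ^+ 2] =
  2 * (1 - 2 * y ^+ 2) * ((S j.+2).[1 - 2 * y ^+ 2] - (S j.+1).[1 - 2 * y ^+ 2])
  - ((S j.+1).[1 - 2 * y ^+ 2] - (S j).[1 - 2 * y ^+ 2]).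
  by rewrite [(S j.+3).[_]]horner_chebS_rec [(S j.+2).[_]]horner_chebS_rec; ring.
have e4 : (S j.*2.+4.+1).[y] =
   (4 * y ^+ 2 - 2) * (S j.*2.+3).[y] - (S j.*2.+1).[y].
  by rewrite !horner_chebS_rec; ring.
by rewrite IH1 IH2 e4 !exprS; ring.
Qed.

End EvenNodes.

Section EvenBound.
Variables (R : realType) (n : nat).
Hypothesis n_gt0 : (0 < n)%N.
Let N := n.*2.

Local Notation S := (chebS R).
Implicit Types (x y : R).

(** The node polynomial $(n+1)U_{n+1} + (n+2)U_n = (1+x)(U_{n+1}-U_n)'$. *)
Definition radau : {poly R} := n.+1%:R *: S n.+2 + n.+2%:R *: S n.+1.

Definition critical : {poly R} := (S n.+2)^`() - (S n.+1)^`().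

(** The factor 1 + x accounts for the node -1. *)
Lemma radauE : radau = (1 + 'X) * critical.
Proof.
have X1 : (1 - 'X : {poly R}) != 0 by rewrite -opprB oppr_eq0 polyXsubC_eq0.
apply: (mulfI X1).
have -> : (1 - 'X) * ((1 + 'X) * critical) =
  (1 - 'X ^+ 2) * (S n.+2)^`() - (1 - 'X ^+ 2) * (S n.+1)^`().
  by rewrite /critical; ring.
rewrite !chebS_deriv [S n.+3]chebS_rec /radau -!mul_polyC !polyC_natr.
by rewrite -![_.+1%:R]natr1; ring.
Qed.

Lemma size_radau : size radau = n.+2.
Proof.
have size_term k j : size (k.+1%:R *: S j.+1) = j.+1.
  by rewrite size_scale ?pnatr_eq0 // (size_chebS _ _).1.
by rewrite size_polyDl !size_term.
Qed.

Lemma radau_node k : (k <= n)%N -> 0 < (-1) ^+ k * radau.[cos (node R n.+1 k)].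
Proof.
move=> kn; rewrite hornerD !hornerZ.
have [->|k0] := posnP k.
  rewrite /node !mul0r cos0 !chebS_at1 expr0 mul1r.
  by rewrite -!natrM -natrD ltr0n; lia.
have kn' : (0 < k < n.+1)%N by lia.
rewrite chebS_node // chebS_node_succ // mulr0 addr0 mulrCA -exprMn mulrNN mulr1.
by rewrite expr1n mulr1 ltr0n.
Qed.

(** By [radau_node] the node polynomial alternates in sign at the points
    $\cos\frac{k\pi}{n+1}$, k = 0, ..., n. *)
Lemma radau_interlacing : exists e : nat -> R, forall k, (k < n)%N ->
  [/\ cos (node R n.+1 k.+1) < e k, e k < cos (node R n.+1 k) & root radau (e k)].
Proof.
suff /choice[e eP] : forall k, exists x, (k < n)%N ->
  [/\ cos (node R n.+1 k.+1) < x, x < cos (node R n.+1 k) & root radau x].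
  by exists e.
move=> k; have [kn|] := ltnP k n; last by exists 0.
have lt_c : cos (node R n.+1 k.+1) < cos (node R n.+1 k).
  by apply: cos_node_lt; lia.
have sgn : radau.[cos (node R n.+1 k.+1)] * radau.[cos (node R n.+1 k)] < 0.
  have := mulr_gt0 (radau_node kn) (radau_node (ltnW kn)).
  rewrite mulrACA -exprD addSn addnn exprS -signr_odd odd_double expr0 mulr1.
  by rewrite mulN1r oppr_gt0.
have [x + rx] := poly_ivtoo (ltW lt_c) sgn.
by rewrite in_itv /= => /andP[x1 x2]; exists x.
Qed.

Variable e : nat -> R.
Hypothesis eP : forall k, (k < n)%N ->
  [/\ cos (node R n.+1 k.+1) < e k, e k < cos (node R n.+1 k) & root radau (e k)].

Let e_itv k : (k < n)%N -> -1 < e k < 1.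
Proof.
move=> kn; have [e1 e2 _] := eP kn; apply/andP; split.
  apply: lt_trans e1; have : (0 < k.+1 < n.+1)%N by lia.
  by move/(cos_node_itv R)/andP => [].
have [k0|k0] := posnP k; first by move: e2; rewrite k0 /node !mul0r cos0.
apply: lt_trans e2 _; have : (0 < k < n.+1)%N by lia.
by move/(cos_node_itv R)/andP => [].
Qed.

Let e_decr i j : (i < j < n)%N -> e j < e i.
Proof.
move=> /andP[ij jn]; have [_ e2 _] := eP jn.
have [e1 _ _] := eP (ltn_trans ij jn); apply: lt_trans e2 (le_lt_trans _ e1).
have [->|ne] := eqVneq j i.+1; first by [].
by rewrite ltW // cos_node_lt //; lia.
Qed.

Definition radau_nodes : seq R := -1 :: [seq e k | k <- iota 0 n].

Let nodesP x : x \in radau_nodes -> x = -1 \/ exists2 k, (k < n)%N & x = e k.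
Proof.
rewrite inE => /orP[/eqP|/mapP[k + ->]]; first by left.
by rewrite mem_iota => kn; right; exists k.
Qed.

Lemma size_radau_nodes : size radau_nodes = n.+1.
Proof. by rewrite /= size_map size_iota. Qed.

Lemma radau_nodes_uniq : uniq radau_nodes.
Proof.
rewrite /=; apply/andP; split.
  apply/mapP => -[k]; rewrite mem_iota => /= kn; have /andP[+ _] := e_itv kn.
  by move=> + ek; rewrite -ek ltxx.
rewrite map_inj_in_uniq ?iota_uniq // => i j; rewrite !mem_iota /= => iM jM eij.
have [ij|ij|//] := ltngtP i j.
  by have := @e_decr i j; rewrite ij jM eij ltxx => /(_ isT).
by have := @e_decr j i; rewrite ij iM eij ltxx => /(_ isT).
Qed.

Lemma radau_nodes_itv x : x \in radau_nodes -> -1 <= x <= 1.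
Proof.
case/nodesP => [->|[k kn ->]]; first by rewrite lexx; lra.
by have /andP[? ?] := e_itv kn; rewrite !ltW.
Qed.

Lemma eta_itv : -1 < e 0 < 1.
Proof. exact: e_itv. Qed.

Lemma eta_radau_nodes : e 0 \in radau_nodes.
Proof. by rewrite inE; apply/orP; right; apply/mapP; exists 0%N; rewrite ?mem_iota. Qed.

Lemma radau_nodes_max x : x \in radau_nodes -> x <= e 0.
Proof.
case/nodesP => [->|[k kn ->]]; first by have /andP[/ltW] := eta_itv.
by have [->//|k0] := posnP k; rewrite ltW // e_decr // k0.
Qed.

Lemma inner_radau_nodes :
  (n <= (size [seq x <- radau_nodes | (-1 < x < e 0)%R]).+1)%N.
Proof.
rewrite size_filter /radau_nodes -[n in iota 0 n]prednK //= !count_map.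
rewrite -[n in (n <= _)%N]prednK // ltnS.
rewrite (leq_trans _ (leq_addl _ _)) // (leq_trans _ (leq_addl _ _)) //.
rewrite (@eq_in_count _ _ predT).
  by rewrite count_predT size_iota.
move=> k; rewrite mem_iota => /andP[k0 kn] /=.
have kn' : (k < n)%N by lia.
by have /andP[-> _] := e_itv kn'; rewrite e_decr // k0.
Qed.

Lemma radau_nodes_roots : all (root radau) radau_nodes.
Proof.
apply/allP => x /nodesP[->|[k kn ->]]; last by have [] := eP kn.
by apply/rootP; rewrite radauE hornerM !(hornerD, hornerC, hornerX) subrr mul0r.
Qed.

Let N_gt0 : (0 < N)%N. Proof. by rewrite /N; lia. Qed.
Let xs_k : (size radau_nodes <= n.+1)%N. Proof. by rewrite size_radau_nodes. Qed.
Let xs_N : (size radau_nodes <= N.+1)%N. Proof. by rewrite size_radau_nodes /N; lia. Qed.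
Let exact_N : (N.+1 <= size radau_nodes + n)%N.
Proof. by rewrite size_radau_nodes /N; lia. Qed.
Let W_size : size radau = (size radau_nodes).+1.
Proof. by rewrite size_radau size_radau_nodes. Qed.
Let W_orth M (g : {poly R}) : (N < M)%N -> (size g <= n)%N ->
  (size radau_nodes + n < 2 * M)%N -> sinquad M (radau * g) = 0.
Proof.
rewrite size_radau_nodes /N => NM gn nM.
rewrite /radau mulrDl -!scalerAl linearD !linearZ /=.
by rewrite !sinquad_chebS_orth ?mulr0 ?addr0 //; lia.
Qed.

Lemma even_second_coef_le (P : {poly R}) :
  typically_real_poly N P -> P`_2 <= 2 * e 0.
Proof.
exact: (second_coef_le N_gt0 radau_nodes_uniq xs_k xs_N exact_N W_size
  radau_nodes_roots W_orth eta_radau_nodes radau_nodes_itv radau_nodes_max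
  inner_radau_nodes).
Qed.

Lemma even_upper_extremizer_uniq (P Q : {poly R}) :
  upper_extremizer N (2 * e 0) P -> upper_extremizer N (2 * e 0) Q -> P = Q.
Proof.
exact: (upper_extremizer_uniq N_gt0 radau_nodes_uniq xs_k xs_N exact_N W_size
  radau_nodes_roots W_orth eta_radau_nodes radau_nodes_itv radau_nodes_max
  inner_radau_nodes).
Qed.

Lemma even_second_coef_eq (P : {poly R}) : typically_real_poly N P ->
  (forall x, x \in radau_nodes -> x != e 0 -> (profile P).[x] = 0) ->
  P`_2 = 2 * e 0.
Proof.
exact: (second_coef_eq N_gt0 radau_nodes_uniq xs_k xs_N exact_N W_size
  radau_nodes_roots W_orth eta_radau_nodes inner_radau_nodes).
Qed.

Lemma critical_root : root critical (e 0).
Proof.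
have /allP/(_ _ eta_radau_nodes)/rootP := radau_nodes_roots.
rewrite radauE hornerM => /eqP; rewrite mulf_eq0 => /orP[|h]; last by rewrite rootE.
rewrite !(hornerD, hornerC, hornerX) addr_eq0 => /eqP h.
by have /andP[e1 _] := eta_itv; move: e1; lra.
Qed.

(** Every zero of the derivative is a node, because the n + 1 nodes exhaust the
    zeros of the node polynomial. *)
Lemma eta_maximal_root : maximal_root critical (e 0).
Proof.
split; first exact: critical_root.
move=> y /rootP cy; apply: radau_nodes_max.
have : root radau y by apply/rootP; rewrite radauE hornerM cy mulr0.
rewrite (all_roots_prod_XsubC W_size radau_nodes_roots) ?uniq_rootsE ?radau_nodes_uniq //.
rewrite rootZ ?root_prod_XsubC //.
by rewrite lead_coef_eq0 -size_poly_eq0 size_radau.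
Qed.

(** ** The two descriptions of the bound *)

Lemma deriv_chebS_half_angle y :
  4 * y * critical.[1 - 2 * y ^+ 2] = (-1) ^+ n * ((S N.+3)^`()).[y].
Proof.
have E : (S n.+2 - S n.+1) \Po (1 - 2 * 'X ^+ 2) = (-1) ^+ n.+1 *: S N.+3.
  apply: poly_ext_gt1 => x _; rewrite horner_comp hornerD hornerN hornerZ.
  have -> : (1 - 2 * 'X ^+ 2 : {poly R}).[x] = 1 - 2 * x ^+ 2.
    by rewrite two_polyC !(horner_exp, hornerD, hornerN, hornerM, hornerC, hornerX).
  by rewrite chebS_half_angle.
have := congr1 (fun p : {poly R} => (p^`()).[y]) E.
rewrite deriv_comp derivZ hornerM horner_comp hornerZ derivB -/critical.
have -> : (1 - 2 * 'X ^+ 2 : {poly R}).[y] = 1 - 2 * y ^+ 2.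
  by rewrite two_polyC !(horner_exp, hornerD, hornerN, hornerM, hornerC, hornerX).
have -> : ((1 - 2 * 'X ^+ 2 : {poly R})^`()).[y] = - (4 * y).
  rewrite derivB -[1]/(1%:P) derivC sub0r two_polyC mul_polyC derivZ derivXn hornerN.
  by rewrite hornerZ hornerMn /= ?expr1 hornerX; ring.
by rewrite [(-1) ^+ n.+1]exprS => h; apply: oppr_inj; rewrite -mulNr mulrC h; ring.
Qed.

Lemma nu_eta : exists2 nu, smallest_positive_root (S N.+3)^`() nu &
  e 0 = 1 - 2 * nu ^+ 2.
Proof.
have /andP[e1 e2] := eta_itv.
have nu2 : (Num.sqrt ((1 - e 0) / 2)) ^+ 2 = (1 - e 0) / 2 by rewrite sqr_sqrtr //; lra.
exists (Num.sqrt ((1 - e 0) / 2)); last by rewrite nu2; field.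
have sN : (-1) ^+ n != 0 :> R by rewrite signr_eq0.
split.
- by rewrite sqrtr_gt0; lra.
- apply/rootP/(mulfI sN); rewrite mulr0 -deriv_chebS_half_angle nu2.
  have -> : 1 - 2 * ((1 - e 0) / 2) = e 0 by field.
  by rewrite (rootP critical_root) mulr0.
- move=> y y0 /rootP Sy; have [_ /(_ (1 - 2 * y ^+ 2))] := eta_maximal_root.
  have h : root critical (1 - 2 * y ^+ 2).
    have := deriv_chebS_half_angle y; rewrite Sy mulr0 => /eqP.
    by rewrite !mulf_eq0 pnatr_eq0 (gt_eqF y0).
  move=> /(_ h) le_eta; have -> : y = Num.sqrt (y ^+ 2) by rewrite sqrtr_sqr gtr0_norm.
  by apply: ler_wsqrtr; lra.
Qed.

End EvenBound.

(** * Even degree: the extremal polynomial *)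

Section Autocorrelation.
Variable R : realType.
Implicit Types (z : R).

Lemma sum_diagonals (F : nat -> nat -> R) N :
  \sum_(i < N) \sum_(j < N) F i j =
  \sum_(i < N) F i i +
  \sum_(s < N) \sum_(k < N - s.+1) (F k (k + s.+1)%N + F (k + s.+1)%N k).
Proof.
elim: N => [|N IH]; first by rewrite !big_ord0 addr0.
under eq_bigr => i _ do rewrite big_ord_recr /=.
rewrite big_split /= big_ord_recr /= IH [\sum_(i < N.+1) F i i]big_ord_recr /=.
rewrite [in RHS]big_ord_recr /= subnn big_ord0 addr0.
have -> : \sum_(s < N) \sum_(k < N.+1 - s.+1) (F k (k + s.+1)%N + F (k + s.+1)%N k) =
    \sum_(s < N) \sum_(k < N - s.+1) (F k (k + s.+1)%N + F (k + s.+1)%N k)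
    + \sum_(i < N) (F i N + F N i).
  rewrite [X in _ = X + _](reindex_inj rev_ord_inj) /=.
  rewrite [in LHS](reindex_inj rev_ord_inj) /= -big_split /=; apply: eq_bigr => s _.
  have sN := ltn_ord s.
  have -> : (N.+1 - (N - s.+1).+1 = s.+1)%N by lia.
  have -> : (N - (N - s.+1).+1 = s)%N by lia.
  rewrite big_ord_recr /=; congr (_ + (F _ _ + F _ _)); lia.
rewrite [\sum_(i < N.+1) F i N]big_ord_recr /= [\sum_(i < N) (_ + _)]big_split /=.
by ring.
Qed.

(** Abel summation, from
    $(z-1/z)(z^s+z^{-s})=(z^{s+1}-z^{-s-1})-(z^{s-1}-z^{-s+1})$. *)
Lemma sum_by_parts z (c : nat -> R) m : z != 0 ->
  (z - z^-1) * (c 0 + \sum_(s < m) c s.+1 * (z ^+ s.+1 + z^-1 ^+ s.+1)) =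
  \sum_(s < m) (c s - c s.+2) * (z ^+ s.+1 - z^-1 ^+ s.+1)
  + c m * (z ^+ m.+1 - z^-1 ^+ m.+1) + c m.+1 * (z ^+ m - z^-1 ^+ m).
Proof.
move=> z0; elim: m => [|m IH]; first by rewrite !big_ord0 !expr1 !expr0; ring.
rewrite !big_ord_recr /= addrA mulrDr IH !exprS.
by field.
Qed.

(** This is $\sum_s(g_s-g_{s+2})U_{s-1}(\cos t)=|\sum_k f_ke^{ikt}|^2$,
    continued off the unit circle. It is the Fejer-Riesz representation of a
    nonnegative trigonometric polynomial, written in the Chebyshev basis. *)
Lemma autocorrelation_profile N (f : nat -> R) z : 1 < z ->
  let g s := \sum_(1 <= k < N.+2 - s) f k * f (k + s - 1)%N in
  (\sum_(s < N) (g s.+1 - g (s.+1 + 2)%N) *: chebS R s.+1).[(z + z^-1) / 2] =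
  (\sum_(k < N) f k.+1 * z ^+ k.+1) * (\sum_(k < N) f k.+1 * z^-1 ^+ k.+1).
Proof.
move=> z1 g.
have z0 : z != 0 by rewrite gt_eqF // (lt_trans ltr01).
have zz : z - z^-1 != 0.
  rewrite subr_eq0 gt_eqF // (lt_trans _ z1) //.
  by rewrite invf_lt1 // (lt_trans ltr01).
apply: (mulIf zz); rewrite horner_sum mulr_suml.
have gN s : (N < s)%N -> g s = 0 by move=> Ns; rewrite /g big_geq //; lia.
transitivity ((z - z^-1) * (g 1 + \sum_(s < N) g s.+2 * (z ^+ s.+1 + z^-1 ^+ s.+1))).
  rewrite (@sum_by_parts z (fun s => g s.+1)) // [g N.+1]gN // [g N.+2]gN //.
  rewrite !mul0r !addr0; apply: eq_bigr => s _.
  by rewrite hornerZ -mulrA chebS_joukowski // addn2.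
rewrite mulrC; congr (_ * _).
rewrite mulr_suml; under [RHS]eq_bigr => i _ do rewrite mulr_sumr.
rewrite (@sum_diagonals (fun i j => f i.+1 * z ^+ i.+1 * (f j.+1 * z^-1 ^+ j.+1))).
have gE s : g s.+1 = \sum_(k < N - s) f k.+1 * f (k + s).+1.
  rewrite /g subSS big_add1 /= big_mkord (_ : (N.+1 - s).-1 = N - s)%N; last by lia.
  by apply: eq_bigr => k _; congr (_ * f _); lia.
congr (_ + _).
  rewrite gE subn0; apply: eq_bigr => k _; rewrite addn0 exprVn.
  by field; rewrite expf_neq0.
apply: eq_bigr => s _; rewrite gE mulr_suml; apply: eq_bigr => k _.
rewrite -!addSn !exprD !exprVn.
by field; rewrite !expf_neq0.
Qed.

End Autocorrelation.

Section EvenExtremal.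
Variables (R : realType) (n : nat) (eta : R).
Hypothesis n_gt0 : (0 < n)%N.
Hypothesis eta_itv : -1 < eta < 1.
Hypothesis radau_eta : (radau R n).[eta] = 0.
Let N := n.*2.

Local Notation S := (chebS R).
Implicit Types (x y z : R).

Let a : R := n.+1%:R.
Let aE : n%:R = a - 1. Proof. by rewrite /a -natr1; ring. Qed.
Let bE : n.+2%:R = a + 1. Proof. by rewrite /a -[n.+2%:R]natr1. Qed.
Let NE : N%:R = 2 * (a - 1) :> R. Proof. by rewrite -aE /N -mul2n natrM. Qed.
Let a_gt0 : 0 < a. Proof. exact: ltr0Sn. Qed.

Let u : R := (S n.+1).[eta].
Let v : R := (S n.+2).[eta].

Lemma radau_eta_ratio : v = - ((a + 1) / a) * u.
Proof.
move: radau_eta; rewrite hornerD !hornerZ -/u -/v -/a bE => h.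
have a0 := lt0r_neq0 a_gt0; apply: (mulfI a0).
move/eqP: h; rewrite addr_eq0 => /eqP ->; by field.
Qed.

Let c_gt0 : 0 < 2 * a * (a + 1) * (1 + eta).
Proof.
have /andP[e1 _] := eta_itv; have a0 := a_gt0.
by rewrite !mulr_gt0 //; lra.
Qed.

Lemma radau_eta_sqr : u ^+ 2 = a ^+ 2 / (2 * a * (a + 1) * (1 + eta) + 1).
Proof.
have := chebS_invariant n.+1 eta; rewrite -/u -/v radau_eta_ratio => h.
have c0 : 2 * a * (a + 1) * (1 + eta) + 1 != 0.
  by apply/lt0r_neq0; move: c_gt0 => c0; lra.
have a0 := lt0r_neq0 a_gt0.
apply: (mulIf c0); rewrite mulfVK // -[RHS]mulr1 -[X in _ = _ * X]h.
by field.
Qed.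

(** The root condition makes $R_N(\eta)$ rational in eta. *)
Lemma RN_eta : RN N eta = 1 / (2 * (2 * a + 1) * (1 + eta)).
Proof.
have a0 := a_gt0; have c0 := c_gt0; have /andP[e1 _] := eta_itv.
have q2 : qN N eta ^+ 2 = 2 * a * (a + 1) * (1 + eta) + 1.
  rewrite /qN /N doubleK -/N NE -[chebU R n]/(S n.+1) -/u.
  have -> : (2 * (a - 1) + 2) / (2 * u) = a / u.
    have -> : 2 * (a - 1) + 2 = 2 * a by ring.
    by rewrite -mulf_div divff ?mul1r // pnatr_eq0.
  rewrite expr_div_n radau_eta_sqr invf_div mulrCA divff ?mulr1 // expf_neq0 //.
  exact: lt0r_neq0.
rewrite /RN q2 NE addrK; field.
by rewrite !lt0r_neq0 //; lra.
Qed.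

Let rho : R := RN N eta.

Lemma chebS_doubles k x :
  (S k.*2).[x] = 2 * (S k).[x] * ((S k.+1).[x] - x * (S k).[x]) /\
  (S k.*2.+1).[x] = (S k.+1).[x] ^+ 2 - (S k).[x] ^+ 2.
Proof.
elim: k => [|k [IH1 IH2]]; first by rewrite !horner0 !hornerC; split; ring.
have e : (S k.*2.+2).[x] = 2 * (S k.+1).[x] * ((S k.+2).[x] - x * (S k.+1).[x]).
  by rewrite horner_chebS_rec IH1 IH2 horner_chebS_rec; ring.
rewrite doubleS; split=> //.
by rewrite horner_chebS_rec e IH2 horner_chebS_rec; ring.
Qed.

Lemma z1_oddE j : z1 N eta j.*2.+1 =
  (S j.+1).[eta] ^+ 2 - rho *
    (2 * (S j.+1).[eta] * ((S j.+2).[eta] - eta * (S j.+1).[eta]) + 2 * j.+1%:R).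
Proof.
rewrite /z1 /= odd_double /= ?uphalf_double ?doubleK /z1_odd.
have -> : (2 * j.+1 - 1)%N = j.*2.+1 by lia.
by rewrite -[chebU R j.*2.+1]/(S j.+1.*2) (chebS_doubles _ _).1.
Qed.

Lemma z1_evenE j : z1 N eta j.*2.+2 =
  (S j.+1).[eta] * (S j.+2).[eta] - rho *
    ((S j.+2).[eta] ^+ 2 - (S j.+1).[eta] ^+ 2 - 2 * j.+1%:R - 1).
Proof.
rewrite /z1 /= odd_double /= doubleK /z1_even mul2n.
by rewrite -[chebU R j.+1.*2]/(S j.+1.*2.+1) (chebS_doubles _ _).2.
Qed.

(** The tail $\sum_{s\ge 2k-1}z_sz^{s-2k+1}$ of the series with the coefficients
    [z1], times the denominator $(1-z^2)(1+z)(1-2\eta z+z^2)$ of their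
    recurrence, as a function of $p=S_k(\eta)$, $q=S_{k+1}(\eta)$ and k. *)
Let tail (z p q k : R) : R :=
  let f p q k := p ^+ 2 - rho * (2 * p * (q - eta * p) + 2 * k) in
  let g p q k := p * q - rho * (q ^+ 2 - p ^+ 2 - 2 * k - 1) in
  let w := 2 * eta * q - p in let y := 2 * eta * w - q in
  let c1 := f p q k in let c2 := g p q k in
  let c3 := f q w (k + 1) in let c4 := g q w (k + 1) in
  let c5 := f w y (k + 2) in
  c1 + (c2 + (1 - 2 * eta) * c1) * z
  + (c3 + (1 - 2 * eta) * c2 - 2 * eta * c1) * z ^+ 2
  + (c4 + (1 - 2 * eta) * c3 - 2 * eta * c2 + 2 * eta * c1) * z ^+ 3
  + (c5 + (1 - 2 * eta) * c4 - 2 * eta * c3 + 2 * eta * c2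
      + (2 * eta - 1) * c1) * z ^+ 4.

Let den z : R := (1 - z ^+ 2) * (1 + z) * (1 - 2 * eta * z + z ^+ 2).

Let tail_step z p q k : tail z p q k =
  den z * (p ^+ 2 - rho * (2 * p * (q - eta * p) + 2 * k)
           + (p * q - rho * (q ^+ 2 - p ^+ 2 - 2 * k - 1)) * z)
  + z ^+ 2 * tail z q (2 * eta * q - p) (k + 1).
Proof. by rewrite /tail /den /=; ring. Qed.

Let partial_sum z m :
  den z * (\sum_(j < m) (z1 N eta j.*2.+1 * z ^+ j.*2.+1
                         + z1 N eta j.*2.+2 * z ^+ j.*2.+2)) =
  z * (tail z 1 (2 * eta) 1
       - z ^+ m.*2 * tail z (S m.+1).[eta] (S m.+2).[eta] m.+1%:R).
Proof.
elim: m => [|m IH].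
  rewrite big_ord0 mulr0 horner_chebS_rec chebS0 chebS1 horner0 hornerC.
  by rewrite subr0 mulr1 mul1r subrr mulr0.
rewrite big_ord_recr /= mulrDr IH [tail _ (S m.+1).[_] _ _]tail_step.
rewrite z1_oddE z1_evenE -[(S m.+3).[eta]]/(S m.+1.+2).[eta].
rewrite [(S m.+3).[eta]]horner_chebS_rec -[m.+2%:R]natr1.
by rewrite doubleS !exprS; ring.
Qed.

Let tail_start z : tail z 1 (2 * eta) 1 = 2 / (2 * a + 1) * (a + (a + 1) * z).
Proof.
have a0 := a_gt0; have /andP[e1 _] := eta_itv.
by rewrite /tail /= /rho RN_eta; field; rewrite !lt0r_neq0 //; lra.
Qed.

(** The equation of eta enters here: it makes the tail at k = n + 1 a multiple
    of a binomial. *)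
Let tail_end z : tail z u v a =
  2 / (2 * a + 1) * (a * z ^+ 4 + (a + 1) * z ^+ 3).
Proof.
have a0 := a_gt0; have /andP[e1 _] := eta_itv; have c0 := c_gt0.
have hom p q k : tail z p (q * p) k = p ^+ 2 * (tail z 1 q k - tail z 0 0 k)
    + tail z 0 0 k by rewrite /tail /=; ring.
rewrite radau_eta_ratio hom radau_eta_sqr /tail /= /rho RN_eta; field.
by rewrite !lt0r_neq0 //; lra.
Qed.

Let Z z : R := \sum_(k < N) z1 N eta k.+1 * z ^+ k.+1.

Let Z_closed z : den z * Z z = 2 / (2 * a + 1) * z *
  (a * (1 - z ^+ n.*2.+4) + (a + 1) * (z - z ^+ n.*2.+3)).
Proof.
rewrite /Z /N (@sum_pairs R (fun k => z1 n.*2 eta k.+1 * z ^+ k.+1)) partial_sum.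
by rewrite tail_start -/u -/v tail_end !exprS; ring.
Qed.

(** ** The profile of the extremal polynomial *)

Let c s : R := gamma N eta s.+1 - gamma N eta (s.+1 + 2).

(** The numerator of the coefficient formula; its profile is
    $|Z(e^{it})|^2$. *)
Let H : {poly R} := 'X * \poly_(s < N) c s.

Let coefH s : H`_s.+1 = if (s < N)%N then c s else 0.
Proof. by rewrite coefXM coef_poly. Qed.

Let size_H : (size H <= N.+1)%N.
Proof.
by rewrite (leq_trans (size_polyMleq _ _)) // size_polyX ltnS size_poly.
Qed.

Let G : {poly R} := profile H.

Let GE : G = \sum_(s < N) c s *: S s.+1.
Proof.
rewrite /G (profile_wide size_H) big_ord_recl chebS0 scaler0 add0r.
by apply: eq_bigr => s _; rewrite coefH ltn_ord.
Qed.

Let G_sqr z : 1 < z -> G.[(z + z^-1) / 2] = Z z * Z z^-1.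
Proof. by move=> gt1; rewrite GE (autocorrelation_profile N (z1 N eta) gt1). Qed.

(** The product Z(z)Z(1/z) is computed from [Z_closed]; its numerator is, up to
    sign, the square of $(a+1)(z^{n+1}-z^{-n-1})+a(z^{n+2}-z^{-n-2})$, with a = n + 1, that
    is, of $(z-1/z)$ times the node polynomial. *)
Let G_radau : G * ('X - eta%:P) ^+ 2 * (1 + 'X) =
  (1 / (2 * (2 * a + 1) ^+ 2)) *: radau R n ^+ 2.
Proof.
apply: poly_ext_joukowski => z z1.
have z0 : z != 0 by rewrite gt_eqF // (lt_trans ltr01).
have zp : 1 + z != 0 by apply/lt0r_neq0; lra.
have z2 : 1 - z ^+ 2 != 0.
  by rewrite subr_eq0 eq_sym gt_eqF // expr_gt1 // ltW ?(lt_trans ltr01).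
have zz : z * z - 1 != 0 by rewrite -expr2 -opprB oppr_eq0.
have zz' : z - z^-1 != 0.
  rewrite subr_eq0 gt_eqF // (lt_trans _ z1) //.
  by rewrite invf_lt1 // (lt_trans ltr01).
have /andP[e1 e2] := eta_itv.
have zd : 1 - 2 * eta * z + z ^+ 2 != 0 by apply/lt0r_neq0; nra.
have a1 : 2 * a + 1 != 0 by apply/lt0r_neq0; move: a_gt0; lra.
have w0 : z ^+ n.+1 != 0 by rewrite expf_neq0.
set w := z ^+ n.+1 in w0.
have e4 : z ^+ n.*2.+4 = w ^+ 2 * z ^+ 2.
  by rewrite /w -exprM muln2 -exprD addn2 doubleS.
have e3 : z ^+ n.*2.+3 = w ^+ 2 * z.
  by rewrite /w -exprM muln2 -exprSr doubleS.
have den_z : den z != 0 by rewrite /den !mulf_neq0.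
have den_zV : den z^-1 = - den z / z ^+ 5 by rewrite /den; field.
have den_zV0 : den z^-1 != 0 by rewrite den_zV mulf_neq0 ?oppr_eq0 // invr_eq0 expf_neq0.
have Zz : Z z = 2 / (2 * a + 1) * z *
    (a * (1 - w ^+ 2 * z ^+ 2) + (a + 1) * (z - w ^+ 2 * z)) / den z.
  by apply: (mulfI den_z); rewrite Z_closed e4 e3 [RHS]mulrC mulfVK.
have ZV : Z z^-1 = 2 / (2 * a + 1) / z *
    (a * (1 - (w ^+ 2 * z ^+ 2)^-1) + (a + 1) * (z^-1 - (w ^+ 2 * z)^-1)) / den z^-1.
  by apply: (mulfI den_zV0); rewrite Z_closed !exprVn e4 e3 [RHS]mulrC mulfVK.
have W : (radau R n).[(z + z^-1) / 2] =
    (a * (w * z - (w * z)^-1) + (a + 1) * (w - w^-1)) / (z - z^-1).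
  apply: (mulIf zz'); rewrite mulfVK // hornerD !hornerZ mulrDl -!mulrA.
  by rewrite !chebS_joukowski // -/a bE !exprVn -/w exprSr.
have XE : (('X - eta%:P) ^+ 2).[(z + z^-1) / 2] =
    ((1 - 2 * eta * z + z ^+ 2) / (2 * z)) ^+ 2.
  by rewrite horner_exp hornerXsubC; field.
have X1 : (1 + 'X : {poly R}).[(z + z^-1) / 2] = (1 + z) ^+ 2 / (2 * z).
  by rewrite !(hornerD, hornerC, hornerX); field.
rewrite [RHS]hornerZ [in RHS]horner_exp W 2!hornerM XE X1.
rewrite G_sqr // Zz ZV den_zV /den.
by field; rewrite z0 zz w0 nat1r -/a a1 zd zp z2.
Qed.

Let critical_eta : root (critical R n) eta.
Proof.
have /andP[e1 _] := eta_itv; have := radau_eta.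
rewrite radauE hornerM => /eqP; rewrite mulf_eq0 => /orP[|h]; last by rewrite rootE.
by rewrite !(hornerD, hornerC, hornerX) addr_eq0 => /eqP h; move: e1; lra.
Qed.

Let Xp1_neq0 : (1 + 'X : {poly R}) != 0.
Proof. by rewrite addrC -[1]opprK -polyCN polyXsubC_eq0. Qed.

Let critical_neq0 : critical R n != 0.
Proof.
have : radau R n != 0 by rewrite -size_poly_eq0 size_radau.
by apply: contraNneq => c0; rewrite radauE c0 mulr0.
Qed.

(** The double zero at eta cancels, which makes the profile 1 + x times a
    square. *)
Let A_ex : exists2 A : {poly R}, critical R n = A * ('X - eta%:P) &
  G = (1 / (2 * (2 * a + 1) ^+ 2)) *: ((1 + 'X) * A ^+ 2).
Proof.
have [A QA] := factor_theorem _ _ critical_eta.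
exists A => //; have X0 : ('X - eta%:P) ^+ 2 != 0 :> {poly R}.
  by rewrite expf_neq0 // polyXsubC_eq0.
apply: (mulIf (mulf_neq0 X0 Xp1_neq0)); rewrite mulrA G_radau radauE QA.
by rewrite -!scalerAl; congr (_ *: _); ring.
Qed.

Let G_ge0 x : -1 <= x <= 1 -> 0 <= G.[x].
Proof.
move=> /andP[x1 _]; have [A _ ->] := A_ex; rewrite hornerZ hornerM horner_exp.
have k0 : 0 <= 1 / (2 * (2 * a + 1) ^+ 2) :> R.
  by rewrite divr_ge0 // mulr_ge0 // sqr_ge0.
rewrite mulr_ge0 // mulr_ge0 ?sqr_ge0 //.
by rewrite !(hornerD, hornerC, hornerX); lra.
Qed.

Let G_neq0 : G != 0.
Proof.
have [A QA ->] := A_ex; rewrite scaler_eq0 negb_or; apply/andP; split.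
  have a1 : 0 < 2 * a + 1 by move: a_gt0; lra.
  by rewrite lt0r_neq0 // divr_gt0 // mulr_gt0 // exprn_gt0.
rewrite mulf_neq0 // expf_neq0 //.
by apply: contraNneq critical_neq0 => A0; rewrite QA A0 mul0r.
Qed.

(** The normalization, being the mean of the squared modulus of Z. *)
Definition radau_mass : R := gamma N eta 1 - gamma N eta 3.

Lemma radau_mass_gt0 : 0 < radau_mass.
Proof.
have <- : sinquad N.+2 G = radau_mass.
  rewrite -[G]mul1r -chebS1 sinquad_chebSM_profile //.
    by rewrite coefH /N double_gt0 n_gt0.
  by move: size_H; lia.
apply: sinquad_gt0 => //.
  by rewrite ltnS (leq_trans (size_profile size_H)).
by move=> x /andP[x1 x2]; apply: G_ge0; rewrite !ltW.
Qed.

Definition even_extremal : {poly R} := radau_mass^-1 *: H.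

Lemma even_extremal_coef s : (1 <= s <= N)%N ->
  even_extremal`_s = even_coef N eta s.
Proof.
case: s => // s /= sN; rewrite coefZ coefH sN /even_coef mulrC.
by [].
Qed.

Lemma even_extremal_0 : even_extremal`_0 = 0.
Proof. by rewrite coefZ coefXM /= mulr0. Qed.

Lemma even_extremal_1 : even_extremal`_1 = 1.
Proof.
rewrite even_extremal_coef /even_coef ?divff //; first exact/lt0r_neq0/radau_mass_gt0.
by rewrite /N double_gt0.
Qed.

Lemma size_even_extremal : (size even_extremal <= N.+1)%N.
Proof. exact: leq_trans (size_scale_leq _ _) size_H. Qed.

Lemma even_extremal_profile : profile even_extremal = radau_mass^-1 *: G.
Proof.
rewrite (profile_wide size_even_extremal) /G (profile_wide size_H) scaler_sumr.
by apply: eq_bigr => j _; rewrite coefZ scalerA.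
Qed.

Lemma even_extremal_typically_real : typically_real_poly N even_extremal.
Proof.
have N0 : (0 < N)%N by rewrite /N double_gt0.
apply/(typically_real_polyP _ N0); split.
- exact: size_even_extremal.
- exact: even_extremal_0.
- exact: even_extremal_1.
move=> x x1; rewrite even_extremal_profile hornerZ mulr_ge0 ?G_ge0 //.
by rewrite invr_ge0 ltW // radau_mass_gt0.
Qed.

Lemma even_extremal_roots x : root (radau R n) x -> x != eta ->
  (profile even_extremal).[x] = 0.
Proof.
move=> rx xe; rewrite even_extremal_profile hornerZ.
have [A QA ->] := A_ex; rewrite hornerZ hornerM horner_exp.
move: rx => /rootP; rewrite radauE QA 2!hornerM hornerXsubC => /eqP.
rewrite !mulf_eq0 subr_eq0 (negbTE xe) orbF => /orP[/eqP ->|/eqP ->].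
  by rewrite mul0r !mulr0.
by rewrite expr0n !mulr0.
Qed.

Definition even_scale : R := radau_mass^-1 * (1 / (2 * (2 * a + 1) ^+ 2)).

Lemma even_profile_poly :
  profile even_extremal * ('X - eta%:P) ^+ 2 * (1 + 'X) =
  even_scale *: radau R n ^+ 2.
Proof.
by rewrite even_extremal_profile -!scalerAl G_radau scalerA.
Qed.

End EvenExtremal.

(** * Even degree: the compact form *)

Section Antisymmetry.
Variable R : realType.

(** A polynomial in 1/z that is also a polynomial in z is constant. *)
Lemma antisymmetric_poly_eq0 (p : {poly R}) :
  (forall z, 1 < z -> p.[z] + p.[z^-1] = 0) -> p = 0.
Proof.
move=> anti; pose m := size p.
have E : 'X^m * p + \sum_(i < m) p`_i *: 'X^(m - i) = 0.
  apply: poly_ext_gt1 => z z1; have z0 : z != 0 by rewrite gt_eqF // (lt_trans ltr01).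
  rewrite horner0 hornerD hornerM hornerXn horner_sum.
  have h : z ^+ m * (p.[z] + p.[z^-1]) = 0 by rewrite anti ?mulr0.
  rewrite -[RHS]h mulrDr; congr (_ + _).
  rewrite [p.[z^-1]]horner_coef mulr_sumr; apply: eq_bigr => -[i im] _ /=.
  rewrite hornerZ hornerXn mulrCA; congr (_ * _).
  by rewrite exprVn expfB_cond // (negbTE z0) ltnW.
apply/polyP => j; rewrite coef0.
have := congr1 (fun q : {poly R} => q`_(m + j)) E.
rewrite coefD coefXnM ltnNge leq_addr /= addKn coef_sum coef0.
case: j => [|j].
  have [m0|m0] := posnP m; first by rewrite nth_default // -/m m0.
  rewrite addn0 (bigD1 (Ordinal m0)) //= coefZ coefXn subn0 eqxx mulr1 big1.
    by move=> h; lra.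
  move=> [i im]; rewrite -val_eqE /= => i0; rewrite coefZ coefXn gtn_eqF ?mulr0 //.
  by lia.
rewrite big1 ?addr0 // => -[i im] _ /=.
by rewrite coefZ coefXn gtn_eqF ?mulr0 //; lia.
Qed.

End Antisymmetry.

Section EvenCompact.
Variables (R : realType) (n : nat) (eta K : R) (P : {poly R}).
Hypothesis eta_itv : -1 < eta < 1.
Hypothesis radau_eta : (radau R n).[eta] = 0.
Hypothesis P0 : P`_0 = 0.
Hypothesis P1 : P`_1 = 1.
Hypothesis P2 : P`_2 = 2 * eta.
Hypothesis P_profile :
  profile P * ('X - eta%:P) ^+ 2 * (1 + 'X) = K *: radau R n ^+ 2.
Let N := n.*2.

Local Notation S := (chebS R).
Implicit Types (x y z : R).

Let a : R := n.+1%:R.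
Let a_gt0 : 0 < a. Proof. exact: ltr0Sn. Qed.

(** The numerator of the compact form over the denominator
    $(1-z)(1+z)^3(1-2\eta z+z^2)^2$, with the unknown constants K and g2. *)
Let g1 : R := 2 - 2 * eta.
Let g2 : R := P`_3 + 3 - 4 * eta - 4 * eta ^+ 2.
Let den z : R := (1 - z) * (1 + z) ^+ 3 * (z ^+ 2 + 1 - 2 * eta * z) ^+ 2.
Let h z : R := (a + 1) ^+ 2 * (1 - z ^+ (N + 2)) + a ^+ 2 * (1 - z ^+ (N + 4))
  + 2 * a * (a + 1) * (z - z ^+ (N + 3)).
Let num z : R :=
  (1 - z ^+ 2) * (z + z ^+ 5 + g1 * (z ^+ 2 + z ^+ 4) + g2 * z ^+ 3)
  + 8 * K * z ^+ 4 * h z.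

Let profile_z z : 1 < z -> P.[z] - P.[z^-1] = (z - z^-1) * K *
  ((a * (z ^+ n.+1 * z - (z ^+ n.+1 * z)^-1)
    + (a + 1) * (z ^+ n.+1 - (z ^+ n.+1)^-1)) / (z - z^-1)) ^+ 2 /
  (((1 - 2 * eta * z + z ^+ 2) / (2 * z)) ^+ 2 * ((1 + z) ^+ 2 / (2 * z))).
Proof.
move=> z1; have z0 : z != 0 by rewrite gt_eqF // (lt_trans ltr01).
have zp : 1 + z != 0 by apply/lt0r_neq0; lra.
have zz' : z - z^-1 != 0.
  rewrite subr_eq0 gt_eqF // (lt_trans _ z1) //.
  by rewrite invf_lt1 // (lt_trans ltr01).
have /andP[e1 e2] := eta_itv.
have zd : 1 - 2 * eta * z + z ^+ 2 != 0 by apply/lt0r_neq0; nra.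
have W : (radau R n).[(z + z^-1) / 2] =
    (a * (z ^+ n.+1 * z - (z ^+ n.+1 * z)^-1)
      + (a + 1) * (z ^+ n.+1 - (z ^+ n.+1)^-1)) / (z - z^-1).
  apply: (mulIf zz'); rewrite mulfVK // hornerD !hornerZ mulrDl -!mulrA.
  by rewrite !chebS_joukowski // -/a -[n.+2%:R]natr1 -/a !exprVn exprSr.
have XE : (('X - eta%:P) ^+ 2).[(z + z^-1) / 2] =
    ((1 - 2 * eta * z + z ^+ 2) / (2 * z)) ^+ 2.
  by rewrite horner_exp hornerXsubC; field.
have X1 : (1 + 'X : {poly R}).[(z + z^-1) / 2] = (1 + z) ^+ 2 / (2 * z).
  by rewrite !(hornerD, hornerC, hornerX); field.
have := congr1 (fun q : {poly R} => q.[(z + z^-1) / 2]) P_profile.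
rewrite 2!hornerM XE X1 hornerZ [in RHS]horner_exp W -mulrA => pE.
rewrite -profile_joukowski // mulrC -[_ * K * _]mulrA -pE -[RHS]mulrA mulfK //.
by rewrite !mulf_neq0 ?expf_neq0 ?invr_eq0 ?mulf_neq0 ?pnatr_eq0.
Qed.

Let num_antisym z : 1 < z ->
  z ^- 4 * (den z * P.[z] - num z) + z ^+ 4 * (den z^-1 * P.[z^-1] - num z^-1) = 0.
Proof.
move=> z1; have z0 : z != 0 by rewrite gt_eqF // (lt_trans ltr01).
have zp : 1 + z != 0 by apply/lt0r_neq0; lra.
have zz : z * z - 1 != 0.
  by rewrite -expr2 subr_eq0 gt_eqF // expr_gt1 // ltW ?(lt_trans ltr01).
have /andP[e1 e2] := eta_itv.
have zd : 1 - 2 * eta * z + z ^+ 2 != 0 by apply/lt0r_neq0; nra.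
have denV : den z^-1 = - den z / z ^+ 8 by rewrite /den; field.
have -> : z ^- 4 * (den z * P.[z] - num z)
    + z ^+ 4 * (den z^-1 * P.[z^-1] - num z^-1) =
  den z / z ^+ 4 * (P.[z] - P.[z^-1]) - z ^- 4 * num z - z ^+ 4 * num z^-1.
  by rewrite denV; field.
rewrite profile_z // /num /h /den.
have w0 : z ^+ n.+1 != 0 by rewrite expf_neq0.
have e2' : z ^+ (N + 2) = (z ^+ n.+1) ^+ 2 by rewrite -exprM muln2 addn2 doubleS.
have e3' : z ^+ (N + 3) = (z ^+ n.+1) ^+ 2 * z.
  by rewrite -exprM muln2 -exprSr doubleS addn3.
have e4' : z ^+ (N + 4) = (z ^+ n.+1) ^+ 2 * z ^+ 2.
  by rewrite -exprM muln2 -exprD doubleS addn2 addn4.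
rewrite ![z^-1 ^+ (N + _)]exprVn e2' e3' e4'.
move: w0; set w := z ^+ n.+1 => w0.
by field; rewrite z0 zz w0 zd zp.
Qed.

Let ep : {poly R} := eta%:P.
Let g1p : {poly R} := 2 - 2 * ep.
Let g2p : {poly R} := (P`_3)%:P + 3 - 4 * ep - 4 * ep ^+ 2.
Let denp : {poly R} :=
  (1 - 'X) * (1 + 'X) ^+ 3 * ('X ^+ 2 + 1 - 2 * ep * 'X) ^+ 2.
Let hp : {poly R} := (a%:P + 1) ^+ 2 * (1 - 'X ^+ (N + 2))
  + a%:P ^+ 2 * (1 - 'X ^+ (N + 4)) + 2 * a%:P * (a%:P + 1) * ('X - 'X ^+ (N + 3)).
Let nump : {poly R} :=
  (1 - 'X ^+ 2) * ('X + 'X ^+ 5 + g1p * ('X ^+ 2 + 'X ^+ 4) + g2p * 'X ^+ 3)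
  + 8 * K%:P * 'X ^+ 4 * hp.

Let natp k : (k%:R : {poly R}) = (k%:R)%:P. Proof. by rewrite polyC_natr. Qed.

Let denpE z : denp.[z] = den z.
Proof.
rewrite /denp /ep !natp !(horner_exp, hornerD, hornerN, hornerM, hornerC, hornerX).
by rewrite /den; ring.
Qed.

Let numpE z : nump.[z] = num z.
Proof.
rewrite /nump /hp /g1p /g2p /ep !natp.
rewrite !(horner_exp, hornerD, hornerN, hornerM, hornerC, hornerX).
by rewrite /num /h /g1 /g2; ring.
Qed.

(** Both sides have the same coefficients up to degree 3, hence their difference
    is $z^4$ times a polynomial, which is antisymmetric under $z \mapsto 1/z$. *)
Let den_mulP : denp * P = nump.
Proof.
pose b := 2 * ep; pose c : {poly R} := (P`_3)%:P; pose r := drop_poly 4 P.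
have PE : P = 'X + b * 'X ^+ 2 + c * 'X ^+ 3 + 'X ^+ 4 * r.
  rewrite -[LHS](poly_take_drop 4) [_ * 'X^4]mulrC; congr (_ + _).
  apply/polyP => i; rewrite coef_take_poly /b /c /ep two_polyC -polyCM.
  rewrite !coefD !mul_polyC !coefZ coefX !coefXn.
  by case: i => [|[|[|[|i]]]] /=; rewrite ?P0 ?P1 ?P2; ring.
pose al := - 4 * ep; pose be := 2 + 4 * ep ^+ 2.
pose d1 := 2 + al; pose d2 := be + 2 * al; pose d3 := al + 2 * be - 2.
pose d5 := 2 - 2 * be - al; pose d6 := - 2 * al - be; pose d7 := - 2 - al.
pose f : {poly R} :=
  (d3 + b * d2 + c * d1) + (b * d3 + c * d2) * 'X
  + (d5 + c * d3) * 'X ^+ 2 + (d6 + b * d5) * 'X ^+ 3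
  + (d7 + b * d6 + c * d5) * 'X ^+ 4 + (- 1 + b * d7 + c * d6) * 'X ^+ 5
  + (- b + c * d7) * 'X ^+ 6 - c * 'X ^+ 7
  - ((1 - g2p) * 'X - g1p * 'X ^+ 2 - 'X ^+ 3).
pose q := f + denp * r - 8 * K%:P * hp.
have E : denp * P - nump = 'X ^+ 4 * q.
  rewrite {1}PE /q /f /nump /denp /g1p /g2p /d1 /d2 /d3 /d5 /d6 /d7 /al /be /b -/c.
  ring.
suff q0 : q = 0 by apply/eqP; rewrite -subr_eq0 E q0 mulr0.
apply: antisymmetric_poly_eq0 => z z1.
have z0 : z != 0 by rewrite gt_eqF // (lt_trans ltr01).
have Ez y : den y * P.[y] - num y = y ^+ 4 * q.[y].
  have := congr1 (fun p : {poly R} => p.[y]) E.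
  rewrite hornerD hornerN [(denp * P).[y]]hornerM [('X ^+ 4 * q).[y]]hornerM.
  by rewrite denpE numpE horner_exp hornerX.
rewrite -(num_antisym z1) !Ez exprVn; field; exact: z0.
Qed.

Let den_mulP_z z : den z * P.[z] = num z.
Proof. by rewrite -numpE -den_mulP [RHS]hornerM denpE. Qed.

(** ** The constants of the compact form *)

(** $P(z)+P(1/z)$ as a polynomial in $(z+1/z)/2$. *)
Let even_part : {poly R} :=
  \sum_(j < size P) P`_j *: (2 *: (S j.+1 - 'X * S j)).

Let even_part_z z : 1 < z -> even_part.[(z + z^-1) / 2] = P.[z] + P.[z^-1].
Proof.
move=> z1; have z0 : z != 0 by rewrite gt_eqF // (lt_trans ltr01).
have zz' : z - z^-1 != 0.
  rewrite subr_eq0 gt_eqF // (lt_trans _ z1) //.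
  by rewrite invf_lt1 // (lt_trans ltr01).
rewrite /even_part horner_sum !horner_coef -big_split /=; apply: eq_bigr => j _.
rewrite !hornerZ -mulrDr; congr (_ * _); apply: (mulIf zz').
rewrite hornerD hornerN hornerM hornerX.
have := chebS_joukowski j.+1 z0; have := chebS_joukowski j z0; rewrite !exprS.
set p := (S j).[_]; set q := (S j.+1).[_] => ep' eq.
have -> : 2 * (q - (z + z^-1) / 2 * p) * (z - z^-1) =
  2 * (q * (z - z^-1)) - (z + z^-1) * (p * (z - z^-1)) by field.
by rewrite ep' eq; ring.
Qed.

(** The symmetric counterpart of the profile relation: its left hand side
    is obtained from the numerator, and the denominator makes it vanish at -1
    and, doubly, at eta. *)
Let numS : {poly R} :=
  - (2 * (4 * 'X ^+ 2 - 2 + 2 * g1%:P * 'X + g2%:P))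
  + 8 * K%:P * (2 * a%:P * (a%:P + 1) * (1 - S (N + 3))
      - (a%:P + 1) ^+ 2 * S (N + 2) - a%:P ^+ 2 * S (N + 4)).

Let numSE x : numS.[x] = - (2 * (4 * x ^+ 2 - 2 + 2 * g1 * x + g2))
  + 8 * K * (2 * a * (a + 1) * (1 - (S (N + 3)).[x])
      - (a + 1) ^+ 2 * (S (N + 2)).[x] - a ^+ 2 * (S (N + 4)).[x]).
Proof.
rewrite /numS !natp !(horner_exp, hornerD, hornerN, hornerM, hornerC, hornerX).
ring.
Qed.

Let numS_factor :
  numS = ('X - eta%:P) ^+ 2 * (- 8%:P * (1 + 'X) * even_part).
Proof.
apply: poly_ext_joukowski => z z1.
have z0 : z != 0 by rewrite gt_eqF // (lt_trans ltr01).
have zp : 1 + z != 0 by apply/lt0r_neq0; lra.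
have zz' : z - z^-1 != 0.
  rewrite subr_eq0 gt_eqF // (lt_trans _ z1) //.
  by rewrite invf_lt1 // (lt_trans ltr01).
have /andP[e1 e2] := eta_itv.
have zd : 1 - 2 * eta * z + z ^+ 2 != 0 by apply/lt0r_neq0; nra.
apply: (mulIf zz').
transitivity (z ^- 4 * num z - z ^+ 4 * num z^-1).
  rewrite numSE.
  have s2 := chebS_joukowski (N + 2) z0; have s3 := chebS_joukowski (N + 3) z0.
  have s4 := chebS_joukowski (N + 4) z0.
  move: s2 s3 s4; set p := (S (N + 2)).[_]; set q := (S (N + 3)).[_].
  set r := (S (N + 4)).[_] => s2 s3 s4.
  set X := (z + z^-1) / 2.
  have -> : (- (2 * (4 * X ^+ 2 - 2 + 2 * g1 * X + g2)) +
      8 * K * (2 * a * (a + 1) * (1 - q) - (a + 1) ^+ 2 * p - a ^+ 2 * r)) * (z - z^-1)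
    = - (2 * (4 * X ^+ 2 - 2 + 2 * g1 * X + g2)) * (z - z^-1)
    + 8 * K * (2 * a * (a + 1) * (z - z^-1 - q * (z - z^-1))
       - (a + 1) ^+ 2 * (p * (z - z^-1)) - a ^+ 2 * (r * (z - z^-1))) by ring.
  rewrite s2 s3 s4 /X /num /h !exprVn.
  have w0 : z ^+ (N + 2) != 0 by rewrite expf_neq0.
  have e3' : z ^+ (N + 3) = z ^+ (N + 2) * z by rewrite -exprSr !addn2 addn3.
  have e4' : z ^+ (N + 4) = z ^+ (N + 2) * z ^+ 2 by rewrite -exprD -addnA.
  rewrite e3' e4'; move: w0; set w := z ^+ (N + 2) => w0.
  by field; rewrite z0 w0.
rewrite -!den_mulP_z [(_ ^+ 2 * _).[_]]hornerM [(_ * even_part).[_]]hornerM.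
rewrite even_part_z // horner_exp hornerXsubC.
rewrite !(hornerN, hornerM, hornerD, hornerC, hornerX).
have denV : den z^-1 = - den z / z ^+ 8 by rewrite /den; field.
by rewrite denV /den; field.
Qed.

(** The zero of the denominator at -1. *)
Let g2_K : g2 = 2 - 4 * eta + 8 * K * a * (a + 1).
Proof.
have : numS.[-1] = 0.
  rewrite numS_factor [(_ ^+ 2 * _).[_]]hornerM [(_ * even_part).[_]]hornerM.
  rewrite [(_ * (1 + 'X)).[_]]hornerM.
  have -> : (1 + 'X : {poly R}).[-1] = 0 by rewrite !(hornerD, hornerC, hornerX) subrr.
  by rewrite mulr0 mul0r mulr0.
rewrite numSE !chebS_opp !chebS_at1.
have sg k : (-1) ^+ (N + k).+1 = - (-1) ^+ k :> R.
  by rewrite -addnS exprD exprS /N -mul2n exprM sqrrN !expr1n; ring.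
rewrite !sg !natrD /N !exprS !expr0.
have -> : n.*2%:R = 2 * (a - 1) :> R by rewrite /a -natr1 -mul2n natrM; ring.
rewrite /g1 => E.
by apply/eqP; rewrite -subr_eq0; apply/eqP; rewrite -[RHS](mulr0 (- 2^-1)) -E; field.
Qed.

Let deriv_numS x : numS^`().[x] = - (2 * (8 * x + 2 * g1))
  - 8 * K * (2 * a * (a + 1) * ((S (N + 3))^`()).[x]
      + (a + 1) ^+ 2 * ((S (N + 2))^`()).[x] + a ^+ 2 * ((S (N + 4))^`()).[x]).
Proof.
have -> : numS = (4 - 2 * g2 + 16 * K * a * (a + 1))%:P - (4 * g1) *: 'X
   - 8 *: 'X^2 - (16 * K * a * (a + 1)) *: S (N + 3)
   - (8 * K * (a + 1) ^+ 2) *: S (N + 2) - (8 * K * a ^+ 2) *: S (N + 4).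
  apply: poly_ext_gt1 => y _; rewrite numSE.
  by rewrite !(hornerXn, hornerD, hornerN, hornerZ, hornerC, hornerX); ring.
rewrite !derivB !derivZ derivC derivX derivXn /=.
by rewrite !(hornerD, hornerN, hornerZ, hornerMn, hornerC, hornerX); ring.
Qed.

Let deriv_numS_eta : numS^`().[eta] = 0.
Proof.
rewrite numS_factor expr2 -mulrA; set q := _ * even_part.
rewrite derivM derivXsubC mul1r hornerD [(_ * _^`()).[_]]hornerM.
by rewrite [(('X - _) * q).[_]]hornerM hornerXsubC subrr !mul0r addr0.
Qed.

(** The double zero of the denominator at eta: the derivative of [numS] vanishes
    there, and the derivatives of the Chebyshev polynomials at eta are quadratic
    forms in $u=U_n(\eta)$ and $v=U_{n+1}(\eta)$, whose ratio is known. *)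
Let K_E : K = (1 - eta ^+ 2) / (2 * a * (a + 1) * (2 * a + 1)).
Proof.
have /andP[e1 e2] := eta_itv; have a0 := a_gt0.
have e0 : 1 - eta ^+ 2 != 0 by apply/lt0r_neq0; nra.
have dS j : ((S j)^`()).[eta] =
    (j.+1%:R * eta * (S j).[eta] - j%:R * (S j.+1).[eta]) / (1 - eta ^+ 2).
  apply: (mulIf e0); rewrite mulfVK //.
  have := congr1 (fun p : {poly R} => p.[eta]) (chebS_deriv R j).
  rewrite !natp !(horner_exp, hornerD, hornerN, hornerM, hornerC, hornerX).
  by rewrite mulrC => ->.
have r := radau_eta_ratio radau_eta; have q := radau_eta_sqr eta_itv radau_eta.
rewrite -/a in r q.
have nE k : (N + k)%:R = 2 * a - 2 + k%:R :> R.
  by rewrite natrD /N -mul2n natrM /a -natr1; ring.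
have [d2 d3] := chebS_doubles n.+1 eta; have [d4 d5] := chebS_doubles n.+2 eta.
rewrite !doubleS in d2 d3 d4 d5.
have := deriv_numS_eta; rewrite deriv_numS !dS -!addnS !nE.
rewrite /N addn2 addn3 addn4 addnS addn4 d4 d5 d3 d2 [(S n.+3).[eta]]horner_chebS_rec.
set u := (S n.+1).[eta] in r q *; set v := (S n.+2).[eta] in r q *.
pose f u v : R := let w := 2 * eta * v - u in
  2 * a * (a + 1) * ((2 * a + 2) * eta * (v ^+ 2 - u ^+ 2)
                     - (2 * a + 1) * (2 * v * (w - eta * v)))
  + (a + 1) ^+ 2 * ((2 * a + 1) * eta * (2 * u * (v - eta * u))
                    - 2 * a * (v ^+ 2 - u ^+ 2))
  + a ^+ 2 * ((2 * a + 3) * eta * (2 * v * (w - eta * v))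
              - (2 * a + 2) * (w ^+ 2 - v ^+ 2)).
have hom k : f u (k * u) = u ^+ 2 * f 1 k by rewrite /f /=; ring.
have c0 : 0 < 2 * a * (a + 1) * (1 + eta) by rewrite !mulr_gt0 //; lra.
have fE : f u v = - (2 * a * (a + 1) * (2 * a + 1)) * (1 + eta).
  by rewrite r hom q /f /=; field; rewrite !lt0r_neq0 //; lra.
move=> E.
have {}E : - (2 * (8 * eta + 2 * g1)) - 8 * K * (f u v / (1 - eta ^+ 2)) = 0.
  by rewrite -[RHS]E /f /=; field.
move: E; rewrite fE /g1 => E.
have k0 : 2 * a * (a + 1) * (2 * a + 1) != 0 by rewrite !mulf_neq0 ?lt0r_neq0 //; lra.
have s0 : 8 * (1 + eta) / (1 - eta ^+ 2) != 0.
  by rewrite !mulf_neq0 ?invr_eq0 ?e0 // lt0r_neq0 //; lra.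
apply: (mulIf (mulf_neq0 k0 s0)); apply/eqP; rewrite -subr_eq0; apply/eqP.
by rewrite -[RHS]E; field; rewrite e0 nat1r -/a !lt0r_neq0 //; lra.
Qed.

Let N_E : N%:R = 2 * (a - 1) :> R.
Proof. by rewrite /N -mul2n natrM /a -natr1; ring. Qed.

Let K_QN : K = QN N eta.
Proof.
have a0 := a_gt0; rewrite K_E /QN N_E; field.
by rewrite nat1r -/a !lt0r_neq0 //; lra.
Qed.

Let g2_gamma2 : g2 = gamma2_star N eta.
Proof.
have a0 := a_gt0; rewrite g2_K K_E /gamma2_star N_E; field.
by rewrite nat1r -/a !lt0r_neq0 //; lra.
Qed.

Lemma even_compact_chorner (z : R[i]) :
  1 - z != 0 -> 1 + z != 0 ->
  z ^+ 2 + 1 - 2 * real_complex R eta * z != 0 ->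
  chorner P z = even_compact N eta z.
Proof.
move=> zm zp zd; have := congr1 (fun p => chorner p z) den_mulP.
have -> : nump = (1 - 'X ^+ 2) * ('X + 'X ^+ 5 + g1%:P * ('X ^+ 2 + 'X ^+ 4)
   + g2%:P * 'X ^+ 3) + 8 * K%:P * 'X ^+ 4 * hp.
  apply: poly_ext_gt1 => y _; rewrite numpE /hp !natp.
  by rewrite !(horner_exp, hornerD, hornerN, hornerM, hornerC, hornerX).
have -> : g1 = gamma1_star eta by rewrite /g1 /gamma1_star; ring.
rewrite g2_gamma2 K_QN /denp /hp /ep !chorner_simp => E.
have aC : real_complex R a = N%:R / 2 + 1.
  rewrite -[a](subrK 1) rmorphD rmorph1; congr (_ + _).
  by rewrite -(rmorph_nat (real_complex R)) N_E rmorphM rmorph_nat mulrC mulKf ?pnatr_eq0.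
rewrite !rmorph1 aC in E; rewrite /even_compact /hN.
move: E zd; set e := real_complex R eta; set c1 := real_complex R (gamma1_star eta).
set c2 := real_complex R (gamma2_star N eta); set q := real_complex R (QN N eta).
set w2 := z ^+ (N + 2); set w3 := z ^+ (N + 3); set w4 := z ^+ (N + 4).
set m : R[i] := N%:R => E zd.
have d0 : (1 - z) * (1 + z) ^+ 3 * (z ^+ 2 + 1 - 2 * e * z) ^+ 2 != 0.
  by rewrite !mulf_neq0 ?expf_neq0.
apply: (mulfI d0); rewrite E.
by field; rewrite zm zp zd.
Qed.

End EvenCompact.

Unset Implicit Arguments.

Theorem theorem6p1 (R : realType) (N : nat) (N_ge2 : (2 <= N)%N) :
  (odd N ->
     (forall P : {poly R}, typically_real_poly N P -> `|P`_2| <= 2 * mu R N) /\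
     exists P : {poly R},
       [/\ forall Q : {poly R}, upper_extremizer N (2 * mu R N) Q <-> Q = P,
           [/\ P`_1 = 1,
               forall j : nat, (1 <= j <= (N - 1) %/ 2)%N ->
                 P`_(2 * j + 1) = odd_coef_odd_index R N j
             & forall j : nat, (1 <= j <= (N - 1) %/ 2)%N ->
                 P`_(2 * j) = odd_coef_even_index R N j],
           forall z : R[i],
             1 - z ^+ 2 != 0 ->
             1 - 2 * z * real_complex R (mu R N) + z ^+ 2 != 0 ->
             chorner P z = odd_compact N z
         & forall Q : {poly R},
             lower_extremizer N (2 * mu R N) Q <-> Q = negate_even_coefs P])
  /\
  (~~ odd N ->
     exists nu eta : R,
       [/\ smallest_positive_root (chebU R (N + 2))^`() nu,
           maximal_root ((chebU R (N %/ 2 + 1))^`() - (chebU R (N %/ 2))^`()) eta,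
           2 * eta = 2 * (1 - 2 * nu ^+ 2),
           forall P : {poly R}, typically_real_poly N P -> `|P`_2| <= 2 * eta
         & exists P : {poly R},
             [/\ forall Q : {poly R}, upper_extremizer N (2 * eta) Q <-> Q = P,
                 forall s : nat, (1 <= s <= N)%N -> P`_s = even_coef N eta s,
                 forall z : R[i],
                   1 - z != 0 -> 1 + z != 0 ->
                   z ^+ 2 + 1 - 2 * real_complex R eta * z != 0 ->
                   chorner P z = even_compact N eta z
               & forall Q : {poly R},
                   lower_extremizer N (2 * eta) Q <-> Q = negate_even_coefs P]]).
Proof.
have N0 : (0 < N)%N by exact: ltn_trans N_ge2.
split=> [Nodd|Neven].
  have [n nE n1] : exists2 n, N = n.*2.-1 & (1 < n)%N.
    by exists N.+1./2; have := odd_double_half N.+1; rewrite /= Nodd; lia.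
  move: N0; rewrite {N N_ge2 Nodd}nE => N0; split.
    by apply: second_coef_norm_le => // P; exact: odd_second_coef_le.
  exists (odd_extremal R n); split.
  - exact: odd_upper_extremizerP.
  - split; first exact: odd_extremal_1.
      by move=> j /andP[j0 jn]; exact: odd_extremal_odd.
    by move=> j /andP[j0 jn]; exact: odd_extremal_even.
  - by move=> z z1 zd; exact: odd_extremal_compact.
  - by apply: lower_extremizerP => // Q; exact: odd_upper_extremizerP.
have [n nE n0] : exists2 n, N = n.*2 & (0 < n)%N.
  by exists N./2; have := odd_double_half N; rewrite (negbTE Neven); lia.
move: N0; rewrite {N N_ge2 Neven}nE => N0.
have [e eP] := radau_interlacing R n0.
have eta1 := eta_itv n0 eP.
have radau0 : (radau R n).[e 0] = 0 by apply/rootP; have [] := eP 0 n0.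
have [nu nuP etaE] := nu_eta n0 eP.
have trP := even_extremal_typically_real n0 eta1 radau0.
have P2 : (even_extremal n (e 0))`_2 = 2 * e 0.
  apply: (even_second_coef_eq n0 eP trP) => x xs xe.
  have /allP/(_ x xs) rx := radau_nodes_roots eP.
  exact: (even_extremal_roots n0 eta1 radau0 rx xe).
have upP Q : upper_extremizer n.*2 (2 * e 0) Q <-> Q = even_extremal n (e 0).
  split=> [upQ|-> //]; exact: (even_upper_extremizer_uniq n0 eP upQ).
exists nu, (e 0); split.
- by rewrite addn2.
- by rewrite divn2 doubleK addn1; exact: (eta_maximal_root n0 eP).
- by rewrite etaE.
- by apply: second_coef_norm_le => // P; exact: (even_second_coef_le n0 eP).
exists (even_extremal n (e 0)); split.
- exact: upP.
- exact: even_extremal_coef.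
- move=> z z1 z2 zd.
  apply: (even_compact_chorner eta1 radau0 _ _ P2
            (even_profile_poly n0 eta1 radau0)) => //.
    exact: even_extremal_0.
  exact: even_extremal_1.
- exact: lower_extremizerP.
Qed.
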